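(* Let $\Gamma=(V,E,s,t)$ be a multiquiver, $\gamma:\mathbb{Z}V\to\mathbb{Z}E$ its incidence matrix, $\mathcal{A}(\Gamma)$ the corresponding twisted generalized Weyl (TGW) algebra, and $\varphi_\Gamma:\mathcal{A}(\Gamma)\to A_E(\Bbbk)$ the canonical representation by differential operators. Then the following statements are equivalent: (i) $\varphi_\Gamma$ is injective; (ii) $\gamma$ is injective; (iii) $R_E$ is a maximal commutative subalgebra of $\mathcal{A}(\Gamma)$; (iv) no connected component of $\Gamma$ is in equilibrium.
   Context: $\Bbbk$ is a field of characteristic zero; rings are associative and unital; $\mathbb{Z}X$ denotes the free abelian group on a set $X$. TGW algebras. A TGW datum $(R,\sigma,t)$ with index set $I$: a $\Bbbk$-algebra $R$, commuting $\Bbbk$-algebra automorphisms $\sigma=(\sigma_i)_{i\in I}$ of $R$, nonzero central elements $t=(t_i)_{i\in I}$ of $R$. Given $\mu=(\mu_{ij})_{i\ne j}$ with $\mu_{ij}\in\Bbbk\setminus\{0\}$, $\mathcal{C}_\mu(R,\sigma,t)$ is the free $R$-ring on symbols $X_i,Y_i$ ($i\in I$) modulo the relations $X_ir=\sigma_i(r)X_i$, $Y_ir=\sigma_i^{-1}(r)Y_i$, $Y_iX_i=t_i$, $X_iY_i=\sigma_i(t_i)$ ($r\in R$, $i\in I$), $X_iY_j=\mu_{ij}Y_jX_i$ ($i\neq j$). It is $\mathbb{Z}I$-graded by $\deg X_i=i$, $\deg Y_i=-i$, $\deg r=0$. The TGW algebra $\mathcal{A}_\mu(R,\sigma,t)$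 is the quotient of $\mathcal{C}_\mu(R,\sigma,t)$ by the sum of all graded ideals having zero intersection with the degree-zero component; it is $\mathbb{Z}I$-graded. Multiquivers. A multiquiver $\Gamma=(V,E,s,t)$ consists of sets $V$ (vertices), $E$ (edges) and functions $s,t:E\to (V\times\mathbb{Z}_{>0})\cup\{\emptyset\}$ such that (no loops) if $s(e)=(u,m)$ and $t(e)=(v,n)$ then $u\ne v$; and (local finiteness) for each $v\in V$ only finitely many $e$ have $s(e)\in\{v\}\times\mathbb{Z}_{>0}$ or $t(e)\in\{v\}\times\mathbb{Z}_{>0}$. If $s(e)=(v,n)$ (resp. $t(e)=(v,n)$), $v$ is the source (resp. target) of $e$, is incident to $e$, and $n$ is the outgoing (resp. incoming) multiplicity of $e$ at $v$. An edge $e$ with $s(e)=\emptyset$ or $t(e)=\emptyset$ is called a leaf. The incidence matrix is $\gamma:\mathbb{Z}V\to\mathbb{Z}E$, $\gamma(v)=\sum_{e\in E}\gamma_{ev}e$, where $\gamma_{ev}=n$ if $t(e)=(v,n)$, $\gamma_{ev}=-n$ if $s(e)=(v,n)$, and $\gamma_{ev}=0$ otherwise. $\mathcal{A}(\Gamma)$ is the TGW algebra $\mathcal{A}_\mu(R_E,\sigma^\Gamma,t^\Gamma)$ with index set $V$, where all $\mu_{ij}=1$, $R_E=\Bbbk[u_e\mid e\in E]$ (polynomial algebra), $\sigma_v(u_e)=u_e-\gamma_{ev}$, $t_v=\prod_{e\in E}u_{ev}$ with $u_{ev}=u_e(u_e+1)\cdots(u_e+\gamma_{ev}-1)$ if $\gamma_{ev}>0$,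 $u_{ev}=1$ if $\gamma_{ev}=0$, $u_{ev}=(u_e-1)(u_e-2)\cdots(u_e-|\gamma_{ev}|)$ if $\gamma_{ev}<0$. The canonical map $R_E\to\mathcal{A}(\Gamma)$ is injective, and $R_E$ is identified with its image. $A_E(\Bbbk)$ is the Weyl algebra: generators $x_e,y_e$ ($e\in E$), relations $[x_e,x_{e'}]=[y_e,y_{e'}]=0$, $[y_e,x_{e'}]=\delta_{ee'}$. For $k=\sum k_ee\in\mathbb{Z}E$ put $z^k=\prod_e z_e^{(k_e)}$ with $z_e^{(p)}=x_e^p$ if $p\ge0$ and $z_e^{(p)}=y_e^{-p}$ if $p<0$. The canonical representation $\varphi_\Gamma:\mathcal{A}(\Gamma)\to A_E(\Bbbk)$ is the algebra homomorphism with $\varphi_\Gamma(X_v)=z^{\gamma(v)}$, $\varphi_\Gamma(Y_v)=z^{-\gamma(v)}$, $\varphi_\Gamma(u_e)=y_ex_e$. Cycles and equilibrium. A subgraph of $\Gamma$ is given by subsets $V'\subseteq V$, $E'\subseteq E$ with $s'(e)=s(e)$ if the source of $e$ lies in $V'$ and $s'(e)=\emptyset$ otherwise, and likewise for $t'$. A multiquiver is a directed cycle if for some $n\ge1$ one can write $V=\{v_1,\dots,v_n\}$, $E=\{e_1,\dots,e_n\}$ (distinct elements) with $s(e_i)=(v_i,n_i)$, $t(e_i)=(v_{i+1},m_i)$, $v_{n+1}=v_1$. It is balanced if $\prod n_i=\prod m_i$. Two multiquivers are sign-equivalent if they become isomorphic after reversing some edges (swapping $s(e)$ and $t(e)$).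 An NND (not necessarily directed) cycle is a multiquiver sign-equivalent to a directed cycle; it is balanced if it is sign-equivalent to a balanced directed cycle. A cycle in $\Gamma$ is a subgraph of $\Gamma$ that is a cycle. Connected components are those of the underlying undirected graph (an edge with neither source nor target forms its own component). A connected component is in equilibrium if it has finitely many vertices, no leaves, and every NND cycle in it is balanced. *)

(* Defs.v *)
From HB Require Import structures.
From Stdlib Require Import Relation_Operators.
From mathcomp Require Import all_boot all_order all_algebra.
From mathcomp Require Import finmap.
From mathcomp Require Import boolp classical_sets functions cardinality.
From mathcomp.multinomials Require Import monalg.

Set Implicit Arguments.
Unset Strict Implicit.
Unset Printing Implicit Defensive.

Import GRing.Theory.

Local Open Scope classical_set_scope.
Local Open Scope ring_scope.
Local Open Scope quotient_scope.

(* [algType K] requires [1 != 0], which a presentation by generators and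
   relations does not provide. A [pzAlgType K] is a possibly zero algebra over
   the commutative ring K, given by its structure map from K to its center. *)
HB.mixin Record isPzAlg (K : comPzRingType) A of GRing.PzRing A := {
  scal : K -> A;
  scal1 : scal 1 = 1;
  scalD : forall c d, scal (c + d) = scal c + scal d;
  scalM : forall c d, scal (c * d) = scal c * scal d;
  scal_central : forall c x, scal c * x = x * scal c
}.

#[short(type="pzAlgType")]
HB.structure Definition PzAlg (K : comPzRingType) :=
  {A of GRing.PzRing A & isPzAlg K A}.

Section MalgPzAlg.
Variables (K : comNzRingType) (M : monomType).

Fact malgC_central (c : K) (x : {malg K[M]}) : c%:MP * x = x * c%:MP.
Proof.
rewrite !malgM_def fgmulUg fgmulgU; apply: eq_bigr => k _.
by rewrite mul1m mulm1 mulrC.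
Qed.

HB.instance Definition _ := isPzAlg.Build K {malg K[M]}
  (rmorph1 _) (rmorphD _) (rmorphM _) malgC_central.
End MalgPzAlg.

Section Ideals.
Variables (K : comPzRingType) (A : pzAlgType K).

Record ideal := Ideal {
  ideal_set :> A -> Prop;
  ideal0 : ideal_set 0;
  idealD : forall x y, ideal_set x -> ideal_set y -> ideal_set (x + y);
  idealM : forall a x b, ideal_set x -> ideal_set (a * x * b)
}.

#[local] Obligation Tactic := idtac.

Program Definition ideal_gen (S : set A) : ideal :=
  @Ideal [set x | forall J : ideal, (forall y, S y -> J y) -> J x] _ _ _.
Next Obligation. by move=> S J _; exact: ideal0. Qed.
Next Obligation. by move=> S x y Sx Sy J SJ; apply: idealD; [exact: Sx|exact: Sy]. Qed.
Next Obligation. by move=> S a x b Sx J SJ; apply: idealM; exact: Sx. Qed.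

Program Definition ideal_sum (P : set ideal) : ideal :=
  @Ideal [set x | exists2 s : seq A,
            (forall y, y \in s -> exists2 J : ideal, P J & J y)
            & x = \sum_(y <- s) y] _ _ _.
Next Obligation. by move=> P; exists [::] => //; rewrite big_nil. Qed.
Next Obligation.
move=> P x y [s Ps ->] [t Pt ->]; exists (s ++ t); last by rewrite big_cat.
by move=> z; rewrite mem_cat => /orP[/Ps|/Pt].
Qed.
Next Obligation.
move=> P a x b [s Ps ->]; exists [seq a * y * b | y <- s].
  by move=> z /mapP[y /Ps[J PJ Jy] ->]; exists J => //; exact: idealM.
by rewrite big_map mulr_sumr mulr_suml.
Qed.

Definition in_ideal (J : ideal) (x : A) : bool := `[< J x >].

Fact in_ideal_zmod_closed J : zmod_closed (in_ideal J).
Proof.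
split=> [|x y]; rewrite !unfold_in; first by apply/asboolP; exact: ideal0.
move=> /asboolP Jx /asboolP Jy; apply/asboolP; apply: idealD => //.
by have := idealM (-1) 1 Jy; rewrite mulr1 mulN1r.
Qed.

HB.instance Definition _ J :=
  GRing.isZmodClosed.Build A (in_ideal J) (in_ideal_zmod_closed J).

Definition ideal_zmod J : zmodClosed A := GRing.ZmodClosed.clone A (in_ideal J) _.

Definition quot_alg J := Quotient.quot (ideal_zmod J).

HB.instance Definition _ J := Choice.on (quot_alg J).
HB.instance Definition _ J := GRing.Zmodule.on (quot_alg J).
HB.instance Definition _ J := EqQuotient.on (quot_alg J).
HB.instance Definition _ J := ZmodQuotient.on (quot_alg J).

Section QuotientRing.
Variable J : ideal.
Local Notation Q := (quot_alg J).

Definition quot_pi (x : A) : Q := \pi_Q x.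
Definition quot_repr (q : Q) : A := repr q.

Lemma quot_reprK : cancel quot_repr quot_pi.
Proof. exact: reprK. Qed.

Lemma quot_pi_eq x y : quot_pi x = quot_pi y <-> J (x - y).
Proof.
rewrite /quot_pi; split=> [/eqP|Jxy]; last apply/eqP.
  by rewrite -Quotient.idealrBE => /asboolP.
by rewrite -Quotient.idealrBE; apply/asboolP.
Qed.

Lemma quot_piD x y : quot_pi (x + y) = quot_pi x + quot_pi y.
Proof. exact: (raddfD (\pi_Q)). Qed.

Definition quot_mul (p q : Q) : Q := quot_pi (quot_repr p * quot_repr q).

Fact quot_mulE x y : quot_mul (quot_pi x) (quot_pi y) = quot_pi (x * y).
Proof.
apply/quot_pi_eq; set x' := quot_repr _; set y' := quot_repr _.
have Jx : J (x' - x) by apply/quot_pi_eq; rewrite quot_reprK.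
have Jy : J (y' - y) by apply/quot_pi_eq; rewrite quot_reprK.
rewrite (_ : _ - _ = 1 * (x' - x) * y' + x * (y' - y) * 1).
  by apply: idealD; exact: idealM.
by rewrite mul1r mulr1 mulrBl mulrBr addrA subrK.
Qed.

Fact quot_mulA : associative quot_mul.
Proof.
move=> p q r; rewrite -(quot_reprK p) -(quot_reprK q) -(quot_reprK r).
by rewrite (quot_mulE (quot_repr q)) (quot_mulE (quot_repr p)) !quot_mulE mulrA.
Qed.

Fact quot_mul1q : left_id (quot_pi 1) quot_mul.
Proof. by move=> p; rewrite -(quot_reprK p) quot_mulE mul1r. Qed.

Fact quot_mulq1 : right_id (quot_pi 1) quot_mul.
Proof. by move=> p; rewrite -(quot_reprK p) quot_mulE mulr1. Qed.

Fact quot_mulDl : left_distributive quot_mul +%R.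
Proof.
move=> p q r; rewrite -(quot_reprK p) -(quot_reprK q) -(quot_reprK r).
by rewrite -quot_piD !quot_mulE mulrDl quot_piD.
Qed.

Fact quot_mulDr : right_distributive quot_mul +%R.
Proof.
move=> p q r; rewrite -(quot_reprK p) -(quot_reprK q) -(quot_reprK r).
by rewrite -quot_piD !quot_mulE mulrDr quot_piD.
Qed.

HB.instance Definition _ := GRing.Zmodule_isPzRing.Build Q
  quot_mulA quot_mul1q quot_mulq1 quot_mulDl quot_mulDr.

Lemma quot_piM x y : quot_pi (x * y) = quot_pi x * quot_pi y.
Proof. by rewrite -quot_mulE. Qed.

Definition quot_scal (c : K) : Q := quot_pi (scal c).

Fact quot_scal1 : quot_scal 1 = 1.
Proof. by rewrite /quot_scal scal1. Qed.

Fact quot_scalD c d : quot_scal (c + d) = quot_scal c + quot_scal d.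
Proof. by rewrite /quot_scal scalD quot_piD. Qed.

Fact quot_scalM c d : quot_scal (c * d) = quot_scal c * quot_scal d.
Proof. by rewrite /quot_scal scalM quot_piM. Qed.

Fact quot_scal_central c (p : Q) : quot_scal c * p = p * quot_scal c.
Proof. by rewrite -(quot_reprK p) /quot_scal -!quot_piM scal_central. Qed.

HB.instance Definition _ := isPzAlg.Build K Q
  quot_scal1 quot_scalD quot_scalM quot_scal_central.
End QuotientRing.
End Ideals.

Definition alg_morphism (K : comPzRingType) (A B : pzAlgType K) (f : A -> B) : Prop :=
  [/\ forall c, f (scal c) = scal c, {morph f : x y / x + y}
    & {morph f : x y / x * y}].

Section Subalgebras.
Variables (K : comPzRingType) (A : pzAlgType K).

Definition subalgebra (S : set A) : Prop :=
  [/\ forall c, S (scal c), forall x y, S x -> S y -> S (x + y)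
    & forall x y, S x -> S y -> S (x * y)].

Definition comm_subalgebra (S : set A) : Prop :=
  subalgebra S /\ forall x y, S x -> S y -> x * y = y * x.

Definition max_comm_subalgebra (S : set A) : Prop :=
  comm_subalgebra S /\
  forall T, comm_subalgebra T -> S `<=` T -> T = S.
End Subalgebras.

Section FreeAlgebra.
Variables (K : comNzRingType) (G : choiceType).

Definition free_alg := {malg K[{fmonom G}]}.
HB.instance Definition _ := PzAlg.on free_alg.

Definition free_gen (g : G) : free_alg := << fmu g >>.

Definition free_eval (B : pzAlgType K) (h : G -> B) (f : free_alg) : B :=
  \sum_(w <- msupp f) scal f@_w * \prod_(g <- (w : seq G)) h g.

Definition presented_alg (rel : free_alg -> free_alg -> Prop) : pzAlgType K :=
  quot_alg (ideal_gen [set fg.1 - fg.2 | fg in [set fg | rel fg.1 fg.2]]).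
End FreeAlgebra.

Section PolynomialAlgebra.
Variables (K : comNzRingType) (E : choiceType).

Definition poly_alg := {malg K[{cmonom E}]}.
HB.instance Definition _ := GRing.ComNzRing.on poly_alg.
HB.instance Definition _ := PzAlg.on poly_alg.

Definition poly_var (e : E) : poly_alg := << ucm e >>.

Definition poly_eval (B : pzAlgType K) (h : E -> B) (p : poly_alg) : B :=
  \sum_(m <- msupp p) scal p@_m * \prod_(e <- finsupp m) h e ^+ m e.
End PolynomialAlgebra.

Section PolynomialMorphisms.
Variables (K : comNzRingType) (E : choiceType).
Local Notation P := (poly_alg K E).

Section Evaluation.
Variables (B : comNzRingType) (h : E -> B).

Definition monom_eval (m : {cmonom E}) : B := \prod_(e <- finsupp m) h e ^+ m e.

Lemma monom_evalEw (d : {fset E}) (m : {cmonom E}) :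
  (finsupp m `<=` d)%fset -> monom_eval m = \prod_(e <- d) h e ^+ m e.
Proof.
move=> le; rewrite /monom_eval (big_fset_incl _ le) //= => e _.
by rewrite memNfinsupp => /eqP ->; rewrite expr0.
Qed.

Fact monom_eval_mmorphism : mmorphism monom_eval.
Proof.
split=> [m1 m2|]; last by rewrite /monom_eval mdom1 big_seq_fset0.
rewrite (monom_evalEw (fsubsetUl (finsupp m1) (finsupp m2))).
rewrite (monom_evalEw (fsubsetUr (finsupp m1) (finsupp m2))).
rewrite -big_split /= /monom_eval mdomD; apply: eq_bigr => e _.
by rewrite cmM exprD.
Qed.

HB.instance Definition _ := isMultiplicative.Build _ _ monom_eval monom_eval_mmorphism.

Lemma monom_evalU e : monom_eval (ucm e) = h e.
Proof. by rewrite /monom_eval mdomU big_seq_fset1 cmUU expr1. Qed.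
End Evaluation.

Lemma poly_eval_mmap (h : E -> P) (p : P) :
  poly_eval h p = mmap (malgC : K -> {malg K[{cmonom E}]}) (monom_eval h) p.
Proof. by []. Qed.

Lemma poly_eval_morphism (h : E -> P) : alg_morphism (poly_eval h).
Proof.
split=> [c|p q|p q]; rewrite !poly_eval_mmap.
- by rewrite mmapC.
- by rewrite mmapD.
- by rewrite rmorphM.
Qed.

Lemma poly_eval_var (h : E -> P) e : poly_eval h (poly_var K e) = h e.
Proof. by rewrite poly_eval_mmap mmapU monom_evalU mul1r. Qed.

Lemma alg_morphism_poly_eval (f : P -> P) (h : E -> P) (p : P) :
  alg_morphism f -> f (poly_eval h p) = poly_eval (f \o h) p.
Proof.
case=> fC fD fM; have f0 : f 0 = 0 by apply: (addrI (f 0)); rewrite -fD !addr0.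
have f1 : f 1 = 1 by exact: (fC 1).
rewrite (big_morph f fD f0); apply: eq_bigr => m _; rewrite fM fC.
congr (_ * _); rewrite (big_morph f fM f1); apply: eq_bigr => e _ /=.
by elim: (m e) => [|n IH]; rewrite ?expr0 // !exprS fM IH.
Qed.

Lemma poly_eval_id (p : P) : poly_eval (@poly_var K E) p = p.
Proof.
rewrite [RHS]monalgE; apply: eq_bigr => m _.
suff -> : \prod_(e <- finsupp m) poly_var K e ^+ m e = << m >> :> P.
  by rewrite /scal /= malgM_def fgmulUU mulr1 mul1m.
have UX e n : poly_var K e ^+ n = << iterop n mmul (ucm e) mone >> :> P.
  elim: n => [//|n IH]; rewrite exprS IH /poly_var malgM_def fgmulUU mulr1.
  by congr << _ >>; case: n {IH} => //=; rewrite mulm1.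
under eq_bigr do rewrite UX.
have UM (m1 m2 : {cmonom E}) : << mmul m1 m2 >> = << m1 >> * << m2 >> :> P.
  by rewrite malgM_def fgmulUU mulr1.
rewrite -(big_morph (fun m : {cmonom E} => << m >> : P) UM (erefl 1)).
congr << _ >>; apply/eqP/cmP => e.
have iterE (f : E) n : iterop n mmul (ucm f) mone e = (n * (f == e))%N.
  by elim: n => [|[|n] IH]; rewrite ?cm1 ?mul0n ?cmU ?mul1n // [iterop _ _ _ _]/= cmM cmU; move: IH => /= ->.
rewrite (big_morph (fun m : {cmonom E} => m e) (cmM e) (cm1 e)).
under eq_bigr do rewrite iterE.
case: (mdomP m e) => em.
  rewrite (big_fsetD1 e) //= eqxx muln1 big1_fset ?addn0 // => f.
  by rewrite in_fsetD1 => /andP[/negbTE -> _]; rewrite muln0.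
rewrite big1_fset // => f fm _; case: eqP => [fe|_]; last by rewrite muln0.
by rewrite -fe fm in em.
Qed.
End PolynomialMorphisms.

Section TGW.
Variables (K : comNzRingType) (R : pzAlgType K) (I : choiceType).

Record tgw_datum := TgwDatum {
  tgw_sigma : I -> R -> R;
  tgw_sigmaV : I -> R -> R;
  tgw_t : I -> R;
  tgw_sigma_morphism : forall i, alg_morphism (tgw_sigma i);
  tgw_sigmaK : forall i, cancel (tgw_sigma i) (tgw_sigmaV i);
  tgw_sigmaVK : forall i, cancel (tgw_sigmaV i) (tgw_sigma i);
  tgw_sigmaC : forall i j r,
    tgw_sigma i (tgw_sigma j r) = tgw_sigma j (tgw_sigma i r);
  tgw_t_neq0 : forall i, tgw_t i != 0;
  tgw_t_central : forall i r, tgw_t i * r = r * tgw_t i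
}.

Variables (D : tgw_datum) (mu : I -> I -> K).

Definition tgw_free : pzAlgType K := free_alg K (R + I + I)%type.

Definition rgen (r : R) : tgw_free := free_gen K (inl (inl r)).
Definition Xgen (i : I) : tgw_free := free_gen K (inl (inr i)).
Definition Ygen (i : I) : tgw_free := free_gen K (inr i).

(* The first three families of relations make the free algebra on R, X, Y the
   free R-ring on X, Y. *)
Inductive tgw_rel : tgw_free -> tgw_free -> Prop :=
  | rel_scal c : tgw_rel (rgen (scal c)) (scal c)
  | rel_add r s : tgw_rel (rgen (r + s)) (rgen r + rgen s)
  | rel_mul r s : tgw_rel (rgen (r * s)) (rgen r * rgen s)
  | rel_Xr i r : tgw_rel (Xgen i * rgen r) (rgen (tgw_sigma D i r) * Xgen i)
  | rel_Yr i r : tgw_rel (Ygen i * rgen r) (rgen (tgw_sigmaV D i r) * Ygen i)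
  | rel_YX i : tgw_rel (Ygen i * Xgen i) (rgen (tgw_t D i))
  | rel_XY i : tgw_rel (Xgen i * Ygen i) (rgen (tgw_sigma D i (tgw_t D i)))
  | rel_XYC i j : i != j ->
      tgw_rel (Xgen i * Ygen j) (scal (mu i j) * (Ygen j * Xgen i)).

Definition tgw_C : pzAlgType K := presented_alg tgw_rel.

Definition gen_deg (g : (R + I + I)%type) : {malg I} :=
  match g with
  | inl (inl _) => 0
  | inl (inr i) => << i >>
  | inr i => - << i >>
  end.

Definition word_deg (w : {fmonom (R + I + I)%type}) : {malg I} :=
  \sum_(g <- (w : seq _)) gen_deg g.

Definition tgw_C_homog (d : {malg I}) : set tgw_C :=
  [set c | exists2 f : free_alg K (R + I + I)%type,
     (forall w, w \in msupp f -> word_deg w = d) & c = quot_pi _ f].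

Definition graded_ideal (J : ideal tgw_C) : Prop :=
  forall x, J x -> exists2 s : seq tgw_C,
    (forall y, y \in s -> J y /\ exists d, tgw_C_homog d y)
    & x = \sum_(y <- s) y.

Definition tgw_radical : ideal tgw_C :=
  ideal_sum [set J | graded_ideal J /\
                     forall x, J x -> tgw_C_homog 0 x -> x = 0].

Definition tgw : pzAlgType K := quot_alg tgw_radical.

Definition tgw_of_free (f : tgw_free) : tgw := quot_pi _ (quot_pi _ f).
Definition tgw_r (r : R) : tgw := tgw_of_free (rgen r).
Definition tgw_X (i : I) : tgw := tgw_of_free (Xgen i).
Definition tgw_Y (i : I) : tgw := tgw_of_free (Ygen i).
End TGW.

#[local] Obligation Tactic := idtac.

Section Multiquivers.
Variables (V E : choiceType).

Definition has_vertex (x : option (V * nat)) (v : V) : bool := omap fst x == Some v.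
Definition multiplicity (x : option (V * nat)) : nat := oapp snd 0%N x.

Record multiquiver := Multiquiver {
  src : E -> option (V * nat);
  tgt : E -> option (V * nat);
  src_gt0 : forall e v n, src e = Some (v, n) -> (0 < n)%N;
  tgt_gt0 : forall e v n, tgt e = Some (v, n) -> (0 < n)%N;
  no_loops : forall e u m v n, src e = Some (u, m) -> tgt e = Some (v, n) -> u != v;
  locally_finite : forall v,
    finite_set [set e | has_vertex (src e) v || has_vertex (tgt e) v]
}.

Variable Gam : multiquiver.

Definition incident (v : V) (e : E) : bool :=
  has_vertex (src Gam e) v || has_vertex (tgt Gam e) v.

Definition leaf (e : E) : bool := (src Gam e == None) || (tgt Gam e == None).

Definition edges_at (v : V) : {fset E} := fset_set [set e | incident v e].

Definition gamma_coef (e : E) (v : V) : int :=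
  if has_vertex (tgt Gam e) v then (multiplicity (tgt Gam e))%:Z
  else if has_vertex (src Gam e) v then - (multiplicity (src Gam e))%:Z
  else 0.

Definition gamma (a : {malg V}) : {malg E} :=
  \sum_(v <- msupp a) \sum_(e <- edges_at v) << a@_v * gamma_coef e v *g e >>.

(* Components are taken in the bipartite incidence graph on V + E, so that an
   edge with neither source nor target is a component by itself. *)
Definition linked : V + E -> V + E -> Prop :=
  clos_refl_sym_trans (V + E)
    (fun x y => if (x, y) is (inl v, inr e) then incident v e else False).
End Multiquivers.

Section Subgraphs.
Variables (V E : choiceType) (Gam : multiquiver V E) (V' : set V) (E' : set E).

Definition restrict_end (x : option (V * nat)) : option (V' * nat) :=
  if x is Some (v, n) then omap (fun v' : V' => (v', n)) (insub v) else None.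

Lemma restrict_endP x v' n :
  restrict_end x = Some (v', n) -> x = Some (val v', n).
Proof.
by case: x => [[v k]|] //=; case: insubP => //= w _ <- [-> ->].
Qed.

Fact subgraph_finite (v : V') :
  finite_set [set e : E' | has_vertex (restrict_end (src Gam (val e))) v
                        || has_vertex (restrict_end (tgt Gam (val e))) v].
Proof.
have := finite_preimage (B := _) (f := val : E' -> E) _ (locally_finite Gam (val v)).
move=> /(_ (in2W val_inj)); apply: sub_finite_set => e /=.
have H x : has_vertex (restrict_end x) v -> has_vertex x (val v).
  rewrite /has_vertex; case Ex: (restrict_end x) => [[w n]|] //= /eqP[wv].
  by rewrite (restrict_endP Ex) wv.
by case/orP => /H ->; rewrite ?orbT.
Qed.

Program Definition subgraph : multiquiver V' E' :=
  @Multiquiver V' E' (fun e => restrict_end (src Gam (val e)))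
    (fun e => restrict_end (tgt Gam (val e))) _ _ _ subgraph_finite.
Next Obligation. by move=> e v n /restrict_endP; exact: src_gt0. Qed.
Next Obligation. by move=> e v n /restrict_endP; exact: tgt_gt0. Qed.
Next Obligation.
move=> e u m v n /restrict_endP Hs /restrict_endP Ht.
by have := no_loops Hs Ht; apply: contra_neq => ->.
Qed.
End Subgraphs.

Section ReverseEdges.
Variables (V E : choiceType) (Gam : multiquiver V E) (r : pred E).

Let rsrc e := if r e then tgt Gam e else src Gam e.
Let rtgt e := if r e then src Gam e else tgt Gam e.

Program Definition reverse_edges : multiquiver V E :=
  @Multiquiver V E rsrc rtgt _ _ _ _.
Next Obligation.
by move=> e v n; rewrite /rsrc; case: ifP => _; [exact: tgt_gt0|exact: src_gt0].
Qed.
Next Obligation.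
by move=> e v n; rewrite /rtgt; case: ifP => _; [exact: src_gt0|exact: tgt_gt0].
Qed.
Next Obligation.
move=> e u m v n; rewrite /rsrc /rtgt; case: ifP => _ H1 H2; last exact: no_loops H1 H2.
by rewrite eq_sym; exact: no_loops H2 H1.
Qed.
Next Obligation.
move=> v; have := locally_finite Gam v; apply: sub_finite_set => e /=.
by rewrite /rsrc /rtgt; case: ifP => // _; rewrite orbC.
Qed.
End ReverseEdges.

Definition mq_iso (V E V' E' : choiceType)
    (Gam : multiquiver V E) (Gam' : multiquiver V' E') : Prop :=
  exists (f : V -> V') (g : E -> E'), [/\ bijective f, bijective g,
    forall e, src Gam' (g e) = omap (fun vn => (f vn.1, vn.2)) (src Gam e)
    & forall e, tgt Gam' (g e) = omap (fun vn => (f vn.1, vn.2)) (tgt Gam e)].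

Definition sign_equivalent (V E V' E' : choiceType)
    (Gam : multiquiver V E) (Gam' : multiquiver V' E') : Prop :=
  exists r : pred E, mq_iso (reverse_edges Gam r) Gam'.

Definition cycle_labelling (V E : choiceType) (Gam : multiquiver V E) (n : nat)
    (v : 'I_n -> V) (e : 'I_n -> E) (out inn : 'I_n -> nat) : Prop :=
  [/\ (0 < n)%N, bijective v, bijective e,
      forall i, src Gam (e i) = Some (v i, out i)
    & forall i, tgt Gam (e i) = Some (v (ordS i), inn i)].

Definition directed_cycle (V E : choiceType) (Gam : multiquiver V E) : Prop :=
  exists n v e out inn, @cycle_labelling V E Gam n v e out inn.

Definition balanced_directed_cycle (V E : choiceType) (Gam : multiquiver V E) : Prop :=
  exists n v e out inn, @cycle_labelling V E Gam n v e out inn /\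
    (\prod_i out i = \prod_i inn i)%N.

Definition nnd_cycle (V E : choiceType) (Gam : multiquiver V E) : Prop :=
  exists (V' E' : choiceType) (Gam' : multiquiver V' E'),
    directed_cycle Gam' /\ sign_equivalent Gam Gam'.

Definition balanced_nnd_cycle (V E : choiceType) (Gam : multiquiver V E) : Prop :=
  exists (V' E' : choiceType) (Gam' : multiquiver V' E'),
    balanced_directed_cycle Gam' /\ sign_equivalent Gam Gam'.

Definition component (V E : choiceType) (Gam : multiquiver V E) (x : V + E) :=
  subgraph Gam [set v | linked Gam x (inl v)] [set e | linked Gam x (inr e)].

Definition in_equilibrium (V E : choiceType) (Gam : multiquiver V E) : Prop :=
  [/\ finite_set [set: V], forall e, ~~ leaf Gam e
    & forall (V' : set V) (E' : set E),
        nnd_cycle (subgraph Gam V' E') -> balanced_nnd_cycle (subgraph Gam V' E')].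

Section WeylAlgebra.
Variables (K : comNzRingType) (E : choiceType).

Definition weyl_free : pzAlgType K := free_alg K (E + E)%type.

Local Notation xgen e := (free_gen K (inl e : E + E) : weyl_free).
Local Notation ygen e := (free_gen K (inr e : E + E) : weyl_free).

Inductive weyl_rel : weyl_free -> weyl_free -> Prop :=
  | weyl_xx e f : weyl_rel (xgen e * xgen f - xgen f * xgen e) 0
  | weyl_yy e f : weyl_rel (ygen e * ygen f - ygen f * ygen e) 0
  | weyl_yx e f : weyl_rel (ygen e * xgen f - xgen f * ygen e) (e == f)%:R.

Definition weyl : pzAlgType K := presented_alg weyl_rel.

Definition weyl_x (e : E) : weyl := quot_pi _ (xgen e).
Definition weyl_y (e : E) : weyl := quot_pi _ (ygen e).

Definition weyl_zpow (e : E) (p : int) : weyl :=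
  if 0 <= p then weyl_x e ^+ `|p|%N else weyl_y e ^+ `|p|%N.

(* The factors commute, so the enumeration order of the support is irrelevant. *)
Definition weyl_z (k : {malg E}) : weyl := \prod_(e <- msupp k) weyl_zpow e k@_e.
End WeylAlgebra.

Section MultiquiverAlgebra.
Variables (K : fieldType) (charK : [pchar K] =i pred0).
Variables (V E : choiceType) (Gam : multiquiver V E).

Local Notation R_E := (poly_alg K E).
Local Notation u := (@poly_var K E).

Definition mq_sigma (v : V) : R_E -> R_E :=
  poly_eval (fun e => u e - (gamma_coef Gam e v)%:~R : R_E).

Definition mq_sigmaV (v : V) : R_E -> R_E :=
  poly_eval (fun e => u e + (gamma_coef Gam e v)%:~R : R_E).

Definition mq_u (e : E) (v : V) : R_E :=
  match gamma_coef Gam e v with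
  | Posz n => \prod_(0 <= i < n) (u e + i%:R)
  | Negz n => \prod_(1 <= i < n.+2) (u e - i%:R)
  end.

(* [mq_u e v = 1] for an edge not incident to v. *)
Definition mq_t (v : V) : R_E := \prod_(e <- edges_at Gam v) mq_u e v.

Fact mq_sigma_morphism v : alg_morphism (mq_sigma v).
Proof. exact: poly_eval_morphism. Qed.

Let poly_eval_comp (h h' : E -> R_E) (p : R_E) :
  (forall e, poly_eval h (h' e) = u e) -> poly_eval h (poly_eval h' p) = p.
Proof.
move=> hh'; rewrite (alg_morphism_poly_eval _ _ (poly_eval_morphism h)).
by rewrite (funext hh' : _ \o _ = u) poly_eval_id.
Qed.

Let poly_eval_shift (h : E -> R_E) e (z : int) :
  poly_eval h (u e + z%:~R) = h e + z%:~R.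
Proof. by rewrite !poly_eval_mmap rmorphD /= rmorph_int -poly_eval_mmap poly_eval_var. Qed.

Fact mq_sigmaK v : cancel (mq_sigma v) (mq_sigmaV v).
Proof. by move=> p; apply: poly_eval_comp => e; rewrite -rmorphN poly_eval_shift rmorphN addrK. Qed.

Fact mq_sigmaVK v : cancel (mq_sigmaV v) (mq_sigma v).
Proof. by move=> p; apply: poly_eval_comp => e; rewrite poly_eval_shift subrK. Qed.

Fact mq_sigmaC v w p : mq_sigma v (mq_sigma w p) = mq_sigma w (mq_sigma v p).
Proof.
pose s w e : R_E := u e - (gamma_coef Gam e w)%:~R.
suff sC : poly_eval (s v) \o s w = poly_eval (s w) \o s v.
  rewrite /mq_sigma -/(s v) -/(s w) (alg_morphism_poly_eval _ _ (poly_eval_morphism (s v))).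
  by rewrite sC -(alg_morphism_poly_eval _ _ (poly_eval_morphism (s w))).
apply: funext => e; rewrite /= /s -!rmorphN !poly_eval_shift !rmorphN; exact: addrAC.
Qed.

Fact mq_t_neq0 v : mq_t v != 0.
Proof.
have nat_neq0 n : (n.+1%:R : K) != 0 by rewrite ((pcharf0P K).1 charK).
pose ev : R_E -> K :=
  mmap idfun (monom_eval (fun e => if 0 <= gamma_coef Gam e v then 1 else 0 : K)).
suff: ev (mq_t v) != 0 by apply: contra_neq => ->; exact: rmorph0.
rewrite /ev rmorph_prod prodf_seq_neq0; apply/allP => e _ /=; rewrite /mq_u.
have evu : ev (u e) = if 0 <= gamma_coef Gam e v then 1 else 0.
  by rewrite /ev mmapU /= mul1r monom_evalU.
case Eg : (gamma_coef Gam e v) evu => [n|n] /= evu;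
    rewrite rmorph_prod prodf_seq_neq0; apply/allP => i /=.
  by rewrite rmorphD rmorph_nat [X in X + _]evu addrC natr1.
rewrite mem_index_iota => /andP[i_gt0 _].
by rewrite rmorphB rmorph_nat [X in X - _]evu sub0r oppr_eq0 -(prednK i_gt0).
Qed.

Definition mq_datum : tgw_datum R_E V :=
  TgwDatum mq_sigma_morphism mq_sigmaK mq_sigmaVK mq_sigmaC mq_t_neq0
    (fun v r => mulrC (mq_t v) r).

Definition mq_tgw : pzAlgType K := tgw mq_datum (fun _ _ => 1).

Definition mq_R : set mq_tgw := range (@tgw_r K R_E V mq_datum (fun _ _ => 1)).

Definition canonical_gen (g : R_E + V + V) : weyl K E :=
  match g with
  | inl (inl r) => poly_eval (fun e => weyl_y K e * weyl_x K e) r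
  | inl (inr v) => weyl_z K (gamma Gam << v >>)
  | inr v => weyl_z K (- gamma Gam << v >>)
  end.

(* The algebra morphism induced on the quotient by [canonical_gen], written as
   the evaluation of a representative: the evaluation vanishes on the relations
   [tgw_rel] and on representatives of elements of [tgw_radical]. *)
Definition canonical_rep (a : mq_tgw) : weyl K E :=
  free_eval canonical_gen (quot_repr (quot_repr a)).
End MultiquiverAlgebra.

Arguments mq_tgw {K} charK {V E} Gam.
Arguments mq_R {K} charK {V E} Gam _.
Arguments canonical_rep {K} charK {V E} Gam a.

(* Main.v *)
Require Import Defs.
From HB Require Import structures.
From Stdlib Require Import Relation_Operators.
From mathcomp Require Import all_boot all_algebra.
From mathcomp Require Import finmap zify ring.
From mathcomp Require Import boolp classical_sets functions cardinality.
From mathcomp.multinomials Require Import monalg.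

(* Write R for the polynomial ring on the u_e. The group ZE acts on R by shifts of
   the u_e, and the Weyl algebra embeds into the skew group ring R # ZE by
   x_e |-> T^e and y_e |-> u_e T^(-e): it is spanned over R by the z^k, and z^k is
   sent to c_k T^k for a regular element c_k of R. Letting ZV act on R through
   gamma, the assignment X_v |-> c_(gamma v) T^v, Y_v |-> c_(- gamma v) T^(-v)
   embeds A(Gamma) into R # ZV: the degree zero part of C is R, so the kernel of
   this map on C is contained in the radical, and conversely a homogeneous element
   of an ideal that meets degree zero trivially dies after multiplication by a
   regular monomial of the opposite degree. In these terms phi_Gamma is the map
   R # ZV -> R # ZE induced by gamma, and the centralizer of R consists of the sums
   of terms r T^a with gamma a = 0; hence the equivalence of (i), (ii) and (iii).

   A vector a lies in the kernel of gamma iff m a_u = n a_v for every edge with ends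
   (u, m) and (v, n), a missing end contributing 0. A nonzero kernel vector
   therefore vanishes nowhere on some component, which is then finite and leafless,
   and multiplying these relations around a cycle shows that it is balanced.
   Conversely, on a component in equilibrium a nowhere vanishing solution of these
   relations is built by adding the edges one at a time: if the two ends of the new
   edge are already linked, a simple path between them closes up to a balanced
   cycle and the new relation holds automatically; otherwise the solution can be
   rescaled on everything linked to one of the ends. *)

Set Implicit Arguments.
Unset Strict Implicit.
Unset Printing Implicit Defensive.

Import GRing.Theory Num.Theory.
Local Open Scope ring_scope.

(** * Free modules and algebra morphisms *)

Section LinearExtension.
Variables (I : choiceType) (G M : zmodType) (h : I -> {additive G -> M}).

Definition malg_lift (g : {malg G[I]}) : M := \sum_(k <- msupp g) h k g@_k.

Lemma malg_liftEw (d : {fset I}) g : (msupp g `<=` d)%fset ->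
  malg_lift g = \sum_(k <- d) h k g@_k.
Proof.
move=> gd; rewrite /malg_lift (big_fset_incl _ gd) // => k _ /mcoeff_outdom ->.
by rewrite raddf0.
Qed.

Fact malg_lift_is_zmod_morphism : {morph malg_lift : x y / x - y}.
Proof.
move=> x y; rewrite (malg_liftEw (msuppB_le x y)).
rewrite (malg_liftEw (fsubsetUl (msupp x) (msupp y))).
rewrite (malg_liftEw (fsubsetUr (msupp x) (msupp y))) -sumrB.
by apply: eq_bigr => k _; rewrite mcoeffB raddfB.
Qed.

HB.instance Definition _ :=
  GRing.isZmodMorphism.Build {malg G[I]} M malg_lift malg_lift_is_zmod_morphism.

Lemma malg_liftU c k : malg_lift << c *g k >> = h k c.
Proof. by rewrite (malg_liftEw msuppU_le) big_seq_fset1 mcoeffUU. Qed.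
End LinearExtension.

Lemma malg_ind (I : choiceType) (G : zmodType) (P : {malg G[I]} -> Prop) :
  P 0 -> (forall x y, P x -> P y -> P (x + y)) ->
  (forall c k, P << c *g k >>) -> forall g, P g.
Proof. by move=> P0 PD PU g; rewrite (monalgE g); apply: big_ind. Qed.

Lemma malg_int_ind (I : choiceType) (P : {malg I} -> Prop) :
  P 0 -> (forall x y, P x -> P y -> P (x + y)) ->
  (forall i, P << i >>) -> (forall i, P (- << i >>)) -> forall g, P g.
Proof.
move=> P0 PD PU PN; have PMn x n : P x -> P (x *+ n).
  by move=> Px; elim: n => [//|n Pxn]; rewrite mulrS; exact: PD.
apply: (malg_ind P0 PD) => -[] n i.
- have -> : << Posz n *g i >> = << i >> *+ n :> {malg I} by rewrite -monalgUMn natz.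
  by apply/PMn/PU.
- have -> : << Negz n *g i >> = (- << i >>) *+ n.+1 :> {malg I}.
    by rewrite mulNrn -monalgUMn -monalgUN natz NegzE.
  by apply/PMn/PN.
Qed.

Lemma mcoeff_sumU (J I : choiceType) (G : zmodType) (f : J -> I) (d : {fset J})
    (F : J -> G) j : injective f ->
  (\sum_(l <- d) << F l *g f l >>)@_(f j) = F j *+ (j \in d).
Proof.
move=> f_inj; rewrite raddf_sum /=; have [jd|jd] := boolP (j \in d).
  rewrite (big_fsetD1 j jd) /= mcoeffUU big1_fset ?addr0 // => l.
  by rewrite in_fsetD1 => /andP[lj _] _; rewrite mcoeffU (inj_eq f_inj) (negbTE lj).
rewrite big1_seq // => l /= ld; rewrite mcoeffU (inj_eq f_inj).
by case: eqP ld jd => // -> ->.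
Qed.

Section PzAlgTheory.
Variables (K : comPzRingType) (A : pzAlgType K).

Fact scal_is_zmod_morphism : {morph (scal : K -> A) : x y / x - y}.
Proof. by move=> x y; apply: (addIr (scal y)); rewrite -scalD !subrK. Qed.

HB.instance Definition _ := GRing.isZmodMorphism.Build K A scal scal_is_zmod_morphism.

Fact scal_is_monoid_morphism : monoid_morphism (scal : K -> A).
Proof. by split; [exact: scal1|exact: scalM]. Qed.

HB.instance Definition _ := GRing.isMonoidMorphism.Build K A scal scal_is_monoid_morphism.
End PzAlgTheory.

Section AlgMorphismTheory.
Variables (K : comPzRingType) (A B : pzAlgType K) (f : A -> B).
Hypothesis f_morph : alg_morphism f.

Lemma alg_morph_scal c : f (scal c) = scal c. Proof. by case: f_morph. Qed.
Lemma alg_morphD : {morph f : x y / x + y}. Proof. by case: f_morph. Qed.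
Lemma alg_morphM : {morph f : x y / x * y}. Proof. by case: f_morph. Qed.

Lemma alg_morph0 : f 0 = 0.
Proof. by apply: (addrI (f 0)); rewrite -alg_morphD !addr0. Qed.

Lemma alg_morph1 : f 1 = 1.
Proof. by rewrite -(scal1 (s := A)) alg_morph_scal scal1. Qed.

Lemma alg_morphB : {morph f : x y / x - y}.
Proof. by move=> x y; apply: (addIr (f y)); rewrite -alg_morphD !subrK. Qed.

Lemma alg_morph_int (z : int) : f z%:~R = z%:~R.
Proof. by rewrite -(rmorph_int (@scal K A)) alg_morph_scal rmorph_int. Qed.

Lemma alg_morph_sum (I : Type) (s : seq I) (F : I -> A) :
  f (\sum_(i <- s) F i) = \sum_(i <- s) f (F i).
Proof. exact: (big_morph f alg_morphD alg_morph0). Qed.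

Lemma alg_morph_prod (I : Type) (s : seq I) (F : I -> A) :
  f (\prod_(i <- s) F i) = \prod_(i <- s) f (F i).
Proof. exact: (big_morph f alg_morphM alg_morph1). Qed.

Lemma alg_morphX x n : f (x ^+ n) = f x ^+ n.
Proof. by elim: n => [|n IHn]; [exact: alg_morph1|rewrite !exprS alg_morphM IHn]. Qed.

Lemma alg_morph_inj : (forall x, f x = 0 -> x = 0) -> injective f.
Proof.
move=> f_inj0 x y fxy; apply/eqP; rewrite -subr_eq0; apply/eqP/f_inj0.
by rewrite alg_morphB fxy subrr.
Qed.

#[local] Obligation Tactic := idtac.
Program Definition ker_ideal : ideal A :=
  @Ideal _ _ [set x | f x = 0]%classic _ _ _.
Next Obligation. exact: alg_morph0. Qed.
Next Obligation. by move=> x y /= fx fy; rewrite alg_morphD fx fy addr0. Qed.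
Next Obligation. by move=> a x b /= fx; rewrite !alg_morphM fx mulr0 mul0r. Qed.
End AlgMorphismTheory.

HB.lock Definition quot_lift (K : comPzRingType) (A B : pzAlgType K) (J : ideal A)
  (f : A -> B) (q : quot_alg J) : B := f (quot_repr q).

Section QuotientLift.
Variables (K : comPzRingType) (A B : pzAlgType K) (J : ideal A) (f : A -> B).
Hypotheses (f_morph : alg_morphism f) (J_ker : forall x, J x -> f x = 0).

Lemma quot_pi_morphism : alg_morphism (quot_pi J).
Proof. by split=> // [x y|x y]; [exact: quot_piD|exact: quot_piM]. Qed.

Lemma quot_lift_pi x : quot_lift f (quot_pi J x) = f x.
Proof.
rewrite quot_lift.unlock; apply/eqP; rewrite -subr_eq0 -(alg_morphB f_morph); apply/eqP/J_ker.
by apply/quot_pi_eq; exact: quot_reprK.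
Qed.

Lemma quot_lift_morphism : alg_morphism (@quot_lift _ _ _ J f).
Proof.
split=> [c|p q|p q]; first by rewrite quot_lift_pi (alg_morph_scal f_morph).
- by rewrite -(quot_reprK p) -(quot_reprK q) -quot_piD !quot_lift_pi (alg_morphD f_morph).
- by rewrite -(quot_reprK p) -(quot_reprK q) -quot_piM !quot_lift_pi (alg_morphM f_morph).
Qed.

Lemma quot_lift_inj : (forall x, f x = 0 -> J x) -> injective (@quot_lift _ _ _ J f).
Proof.
move=> ker_J; apply: (alg_morph_inj quot_lift_morphism) => q.
rewrite -(quot_reprK q) quot_lift_pi => /ker_J Jq.
by rewrite -(alg_morph0 quot_pi_morphism); apply/quot_pi_eq; rewrite subr0.
Qed.
End QuotientLift.

Section MonoidAlgebraEvaluation.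
Variables (K : comNzRingType) (M : monomType) (B : pzAlgType K) (phi : M -> B).

Definition malg_eval (f : {malg K[M]}) : B := \sum_(m <- msupp f) scal f@_m * phi m.

Let scaled (m : M) : {additive K -> B} := phi m \o* @scal K B.

Let malg_evalE : malg_eval = malg_lift scaled. Proof. by []. Qed.

Lemma malg_evalU c m : malg_eval << c *g m >> = scal c * phi m.
Proof. by rewrite malg_evalE malg_liftU. Qed.

Hypotheses (phi1 : phi mone = 1) (phiM : forall m n, phi (mmul m n) = phi m * phi n).

Lemma malg_eval_morphism : alg_morphism malg_eval.
Proof.
have evD : {morph malg_eval : f g / f + g} by rewrite malg_evalE; exact: raddfD.
have ev0 : malg_eval 0 = 0 by rewrite malg_evalE raddf0.
split=> [c||] //; first by rewrite malg_evalU phi1 mulr1.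
move=> f g; elim/malg_ind: f => [|x y evx evy|c m]; first by rewrite mul0r ev0 mul0r.
  by rewrite mulrDl !evD mulrDl evx evy.
elim/malg_ind: g => [|x y evx evy|d n]; first by rewrite mulr0 ev0 mulr0.
  by rewrite mulrDr !evD mulrDr evx evy.
rewrite malgM_def fgmulUU !malg_evalU phiM scalM -!mulrA; congr (_ * _).
by rewrite !mulrA -[phi m * _]scal_central.
Qed.
End MonoidAlgebraEvaluation.

Section FreeAlgebraTheory.
Variables (K : comNzRingType) (G : choiceType).

Lemma free_eval_morphism (B : pzAlgType K) (h : G -> B) :
  alg_morphism (free_eval h : free_alg K G -> B).
Proof.
apply: malg_eval_morphism => [|v w]; first by rewrite fm1 big_nil.
by rewrite fmM big_cat.
Qed.

Lemma free_evalU (B : pzAlgType K) (h : G -> B) c (w : {fmonom G}) :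
  free_eval h << c *g w >> = scal c * \prod_(g <- (w : seq G)) h g.
Proof. exact: malg_evalU. Qed.

Lemma free_eval_gen (B : pzAlgType K) (h : G -> B) g : free_eval h (free_gen K g) = h g.
Proof. by rewrite free_evalU fmU big_seq1 scal1 mul1r. Qed.

Lemma alg_morphism_free_eval (A B : pzAlgType K) (f : A -> B) (h : G -> A) p :
  alg_morphism f -> f (free_eval h p) = free_eval (f \o h) p.
Proof.
move=> f_morph; rewrite (alg_morph_sum f_morph); apply: eq_bigr => w _.
by rewrite (alg_morphM f_morph) (alg_morph_scal f_morph) (alg_morph_prod f_morph).
Qed.

Lemma free_eval_id (p : free_alg K G) : free_eval (@free_gen K G) p = p.
Proof.
rewrite [RHS]monalgE; apply: eq_bigr => -[s] _ /=.
have -> : \prod_(g <- s) free_gen K g = << FMonom s >> :> free_alg K G.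
  elim: s => [|g s IHs]; first by rewrite big_nil -fmoneE.
  by rewrite big_cons IHs /free_gen malgM_def fgmulUU mulr1 /mmul /= fmmulE fmU.
by rewrite /scal /= malgM_def fgmulUU mulr1 mul1m.
Qed.

Variable rel : free_alg K G -> free_alg K G -> Prop.
Local Notation pi := (quot_pi _ : free_alg K G -> presented_alg rel).
Local Notation rel_ideal :=
  (ideal_gen [set fg.1 - fg.2 | fg in [set fg | rel fg.1 fg.2]]%classic).

Lemma presented_pi_morphism : alg_morphism pi.
Proof. exact: (quot_pi_morphism rel_ideal). Qed.

Lemma presented_rel f g : rel f g -> pi f = pi g.
Proof. by move=> fg; apply/quot_pi_eq => J; apply; exists (f, g). Qed.

Lemma presented_ind (P : presented_alg rel -> Prop) :
  P 0 -> (forall x y, P x -> P y -> P (x + y)) ->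
  (forall c s, P (scal c * \prod_(g <- s) pi (free_gen K g))) -> forall x, P x.
Proof.
move=> P0 PD PU x; rewrite -(quot_reprK x) -(free_eval_id (quot_repr x)).
rewrite (alg_morphism_free_eval _ _ presented_pi_morphism).
apply: big_ind => // w _; exact: PU.
Qed.

Variables (B : pzAlgType K) (h : G -> B).
Hypothesis h_rel : forall f g, rel f g -> free_eval h f = free_eval h g.

Definition presented_eval (q : presented_alg rel) : B := quot_lift (free_eval h) q.

Let rel_ker x : rel_ideal x -> free_eval h x = 0.
Proof.
move=> /(_ (ker_ideal (free_eval_morphism h))); apply=> _ [[f g]] /= fg <-.
by rewrite (alg_morphB (free_eval_morphism h)) (h_rel fg) subrr.
Qed.

Lemma presented_eval_pi f : presented_eval (pi f) = free_eval h f.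
Proof. exact: (quot_lift_pi (free_eval_morphism h) rel_ker). Qed.

Lemma presented_eval_morphism : alg_morphism presented_eval.
Proof. exact: (quot_lift_morphism (free_eval_morphism h) rel_ker). Qed.

Lemma presented_eval_gen g : presented_eval (pi (free_gen K g)) = h g.
Proof. by rewrite presented_eval_pi free_eval_gen. Qed.
End FreeAlgebraTheory.

Section CommutingProducts.
Variables (B : pzRingType) (I : choiceType) (F : I -> B).
Hypothesis F_comm : forall i j, GRing.comm (F i) (F j).

Lemma comm_prod_rem i (s : seq I) : i \in s ->
  \prod_(j <- s) F j = F i * \prod_(j <- rem i s) F j.
Proof.
elim: s => [//|j s IHs]; rewrite in_cons eq_sym big_cons /=.
case: eqP => [-> //|_ /= /IHs ->]; rewrite big_cons !mulrA.
by congr (_ * _); exact: F_comm.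
Qed.

Lemma comm_prod_perm (s t : seq I) : perm_eq s t ->
  \prod_(j <- s) F j = \prod_(j <- t) F j.
Proof.
elim: s t => [|i s IHs] t st; first by have -> : t = [::] by apply/perm_nilP; rewrite perm_sym.
have it : i \in t by rewrite -(perm_mem st) mem_head.
rewrite big_cons (comm_prod_rem it) (IHs (rem i t)) //.
by rewrite -(perm_cons i); apply: perm_trans st _; exact: perm_to_rem.
Qed.

Lemma comm_prod_fset_incl (a d : {fset I}) : (a `<=` d)%fset ->
  (forall i, i \notin a -> F i = 1) -> \prod_(i <- a) F i = \prod_(i <- d) F i.
Proof.
move=> ad F1; rewrite -[RHS](big_rmcond (mem a)) // -[RHS]big_filter.
apply: comm_prod_perm; apply: uniq_perm; rewrite ?filter_uniq ?fset_uniq //.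
by move=> i; rewrite mem_filter /=; apply/idP/andP => [ia|[]//]; rewrite (fsubsetP ad).
Qed.
End CommutingProducts.

Section PolynomialEvaluation.
Variables (K : comNzRingType) (E : choiceType).
Local Notation P := (poly_alg K E).
Local Notation u := (@poly_var K E).

Lemma poly_alg_ind (Q : P -> Prop) : (forall c, Q (scal c)) -> (forall e, Q (u e)) ->
  (forall p q, Q p -> Q q -> Q (p + q)) -> (forall p q, Q p -> Q q -> Q (p * q)) ->
  forall p, Q p.
Proof.
move=> QC QU QD QM p; rewrite -(poly_eval_id p).
have Q0 : Q 0 by rewrite -(raddf0 (@scal K P)); exact: QC.
have Q1 : Q 1 by rewrite -(scal1 (s := P)); exact: QC.
apply: (big_ind Q Q0 QD) => m _; apply: (QM _ _ (QC _)).
apply: (big_ind Q Q1 QM) => e _; elim: (m e) => [|n IHn]; first by rewrite expr0.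
by rewrite exprS; exact: (QM _ _ (QU e)).
Qed.

Lemma alg_morph_poly_eval (A B : pzAlgType K) (f : A -> B) (h : E -> A) p :
  alg_morphism f -> f (poly_eval h p) = poly_eval (f \o h) p.
Proof.
move=> f_morph; rewrite (alg_morph_sum f_morph); apply: eq_bigr => m _.
rewrite (alg_morphM f_morph) (alg_morph_scal f_morph) (alg_morph_prod f_morph).
by congr (_ * _); apply: eq_bigr => e _; exact: (alg_morphX f_morph).
Qed.

Variables (B : pzAlgType K) (h : E -> B).
Hypothesis h_comm : forall e f, GRing.comm (h e) (h f).

Lemma comm_poly_eval_morphism : alg_morphism (poly_eval h : P -> B).
Proof.
pose phi (m : {cmonom E}) := \prod_(e <- finsupp m) h e ^+ m e.
have hX_comm (m n : {cmonom E}) e f : GRing.comm (h e ^+ m e) (h f ^+ n f).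
  by apply/commrX/commr_sym/commrX/commr_sym/h_comm.
have phiE (d : {fset E}) (m : {cmonom E}) : (finsupp m `<=` d)%fset ->
    phi m = \prod_(e <- d) h e ^+ m e.
  move=> md; apply: (comm_prod_fset_incl (F := fun e => h e ^+ m e)) => //.
  by move=> e; rewrite -cmE_eq0 => /eqP ->; rewrite expr0.
apply: (@malg_eval_morphism _ _ _ phi) => [|m n]; first by rewrite /phi mdom1 big_seq_fset0.
rewrite (phiE _ _ (fsubsetUl (finsupp m) (finsupp n))).
rewrite (phiE _ _ (fsubsetUr (finsupp m) (finsupp n))) -prodrM_comm //.
by rewrite /phi mdomD; apply: eq_bigr => e _; rewrite cmM exprD.
Qed.

Lemma comm_poly_eval_var e : poly_eval h (u e) = h e.
Proof.
rewrite -[LHS]/(malg_eval (fun m : {cmonom E} => \prod_(e <- finsupp m) h e ^+ m e) _).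
by rewrite malg_evalU mdomU big_seq_fset1 cmUU expr1 scal1 mul1r.
Qed.
End PolynomialEvaluation.

(** * Skew group rings *)

Record alg_action (K : comPzRingType) (G : zmodType) (R : pzAlgType K) := AlgAction {
  act :> G -> R -> R;
  act_morphism : forall k, alg_morphism (act k);
  act0 : forall r, act 0 r = r;
  actD : forall k l r, act (k + l) r = act k (act l r)
}.

Section AlgAction.
Variables (K : comPzRingType) (G : zmodType) (R : pzAlgType K) (a : alg_action G R).

HB.instance Definition _ k :=
  GRing.isZmodMorphism.Build R R (a k) (alg_morphB (act_morphism a k)).

HB.instance Definition _ k := GRing.isMonoidMorphism.Build R R (a k)
  (alg_morph1 (act_morphism a k), alg_morphM (act_morphism a k)).

Lemma act_scal k c : a k (scal c) = scal c.
Proof. exact: alg_morph_scal (act_morphism a k) c. Qed.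

Lemma actK k : cancel (a k) (a (- k)).
Proof. by move=> r; rewrite -actD addNr act0. Qed.

Lemma lreg_act k r : GRing.lreg r -> GRing.lreg (a k r).
Proof.
move=> r_reg p q /(congr1 (a (- k))); rewrite !rmorphM /= actK => /r_reg.
exact: can_inj (actK (- k)) _ _.
Qed.

Variables (H : zmodType) (f : {additive H -> G}).

#[local] Obligation Tactic := idtac.
Program Definition act_pullback : alg_action H R :=
  @AlgAction K H R (fun k => a (f k)) _ _ _.
Next Obligation. by move=> k; exact: act_morphism. Qed.
Next Obligation. by move=> r /=; rewrite raddf0 act0. Qed.
Next Obligation. by move=> k l r /=; rewrite raddfD actD. Qed.
End AlgAction.

Definition skew_ring (K : comPzRingType) (G : zmodType) (R : pzAlgType K)
  (a : alg_action G R) := {malg R[G]}.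

(* [skewU a r k] stands for [r T^k], where [T^k r = a k r T^k]. Monomials and
   products are locked, as comparing elements of [{malg R[G]}] by conversion is
   not feasible. *)
HB.lock Definition skewU (K : comPzRingType) (G : zmodType) (R : pzAlgType K)
  (a : alg_action G R) (r : R) (k : G) : skew_ring a := << r *g k >>.

HB.lock Definition skew_mul (K : comPzRingType) (G : zmodType) (R : pzAlgType K)
    (a : alg_action G R) (x y : skew_ring a) : skew_ring a :=
  \sum_(k <- msupp x) \sum_(l <- msupp y) << x@_k * a k y@_l *g k + l >>.

Section SkewRing.
Variables (K : comPzRingType) (G : zmodType) (R : pzAlgType K) (a : alg_action G R).
Local Notation S := (skew_ring a).

HB.instance Definition _ := GRing.Zmodule.on S.

Lemma mcoeff_skewU r k l : (skewU a r k)@_l = r *+ (k == l).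
Proof. by rewrite skewU.unlock mcoeffU. Qed.

Lemma skewU0 k : skewU a 0 k = 0.
Proof. by rewrite skewU.unlock monalgU0. Qed.

Lemma skewUD r s k : skewU a (r + s) k = skewU a r k + skewU a s k.
Proof. by rewrite skewU.unlock monalgUD. Qed.

Lemma mcoeff_sum_skewU (d : {fset G}) (F : G -> R) k :
  (\sum_(l <- d) skewU a (F l) l)@_k = F k *+ (k \in d).
Proof. by rewrite skewU.unlock (mcoeff_sumU (f := id)). Qed.

Lemma skew_ind (P : S -> Prop) : P 0 -> (forall x y, P x -> P y -> P (x + y)) ->
  (forall r k, P (skewU a r k)) -> forall x, P x.
Proof. by rewrite skewU.unlock; exact: malg_ind. Qed.

Let skew_mulEw (x y : S) (d e : {fset G}) : (msupp x `<=` d)%fset -> (msupp y `<=` e)%fset ->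
  skew_mul x y = \sum_(k <- d) \sum_(l <- e) << x@_k * a k y@_l *g k + l >>.
Proof.
move=> xd ye; rewrite skew_mul.unlock (big_fset_incl _ xd) => [|k _ /mcoeff_outdom ->].
  apply: eq_bigr => k _; apply: (big_fset_incl _ ye) => l _ /mcoeff_outdom ->.
  by rewrite raddf0 mulr0 monalgU0.
by apply: big1 => l _; rewrite mul0r monalgU0.
Qed.

Fact skew_mulDl : left_distributive (@skew_mul _ _ _ a) +%R.
Proof.
move=> x y z; have zz := fsubset_refl (msupp z).
rewrite (skew_mulEw (msuppD_le x y) zz) (skew_mulEw (fsubsetUl (msupp x) (msupp y)) zz).
rewrite (skew_mulEw (fsubsetUr (msupp x) (msupp y)) zz) -big_split; apply: eq_bigr => k _.
by rewrite -big_split; apply: eq_bigr => l _; rewrite mcoeffD mulrDl monalgUD.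
Qed.

Fact skew_mulDr : right_distributive (@skew_mul _ _ _ a) +%R.
Proof.
move=> z x y; have zz := fsubset_refl (msupp z).
rewrite (skew_mulEw zz (msuppD_le x y)) (skew_mulEw zz (fsubsetUl (msupp x) (msupp y))).
rewrite (skew_mulEw zz (fsubsetUr (msupp x) (msupp y))) -big_split; apply: eq_bigr => k _.
by rewrite -big_split; apply: eq_bigr => l _; rewrite mcoeffD raddfD mulrDr monalgUD.
Qed.

Let skew_mul0l (x : S) : skew_mul 0 x = 0.
Proof. by rewrite skew_mul.unlock msupp0 big_seq_fset0. Qed.

Let skew_mul0r (x : S) : skew_mul x 0 = 0.
Proof. by rewrite skew_mul.unlock big1 // => k _; rewrite msupp0 big_seq_fset0. Qed.

Let skew_mul_UU r s k l : skew_mul (skewU a r k) (skewU a s l) = skewU a (r * a k s) (k + l).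
Proof.
by rewrite skewU.unlock (skew_mulEw msuppU_le msuppU_le) !big_seq_fset1 !mcoeffUU.
Qed.

Fact skew_mulA : associative (@skew_mul _ _ _ a).
Proof.
move=> x y z; elim/skew_ind: x => [|x x' IHx IHx'|r k]; first by rewrite !skew_mul0l.
  by rewrite !skew_mulDl IHx IHx'.
elim/skew_ind: y => [|y y' IHy IHy'|s l]; first by rewrite !(skew_mul0l, skew_mul0r).
  by rewrite !(skew_mulDl, skew_mulDr) IHy IHy'.
elim/skew_ind: z => [|z z' IHz IHz'|t m]; first by rewrite !skew_mul0r.
  by rewrite !skew_mulDr IHz IHz'.
by rewrite !skew_mul_UU rmorphM actD mulrA addrA.
Qed.

Fact skew_mul1l : left_id (skewU a 1 0) (@skew_mul _ _ _ a).
Proof.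
elim/skew_ind => [|x y IHx IHy|r k]; first by rewrite skew_mul0r.
  by rewrite skew_mulDr IHx IHy.
by rewrite skew_mul_UU act0 mul1r add0r.
Qed.

Fact skew_mul1r : right_id (skewU a 1 0) (@skew_mul _ _ _ a).
Proof.
elim/skew_ind => [|x y IHx IHy|r k]; first by rewrite skew_mul0l.
  by rewrite skew_mulDl IHx IHy.
by rewrite skew_mul_UU rmorph1 mulr1 addr0.
Qed.

HB.instance Definition _ := GRing.Zmodule_isPzRing.Build S
  skew_mulA skew_mul1l skew_mul1r skew_mulDl skew_mulDr.

Lemma skewU10 : skewU a 1 0 = 1. Proof. by []. Qed.

Lemma skew_mulUU r s k l : skewU a r k * skewU a s l = skewU a (r * a k s) (k + l).
Proof. exact: skew_mul_UU. Qed.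

Fact skew_scal_central (c : K) (x : S) : skewU a (scal c) 0 * x = x * skewU a (scal c) 0.
Proof.
elim/skew_ind: x => [|x y IHx IHy|r k]; first by rewrite mulr0 mul0r.
  by rewrite mulrDr mulrDl IHx IHy.
by rewrite !skew_mulUU act0 act_scal scal_central addr0 add0r.
Qed.

Fact skew_scal1 : skewU a (scal 1) 0 = 1.
Proof. by rewrite scal1 skewU10. Qed.

Fact skew_scalD (c d : K) : skewU a (scal (c + d)) 0 = skewU a (scal c) 0 + skewU a (scal d) 0.
Proof. by rewrite scalD skewUD. Qed.

Fact skew_scalM (c d : K) : skewU a (scal (c * d)) 0 = skewU a (scal c) 0 * skewU a (scal d) 0.
Proof. by rewrite skew_mulUU act0 addr0 scalM. Qed.

HB.instance Definition _ := isPzAlg.Build K S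
  skew_scal1 skew_scalD skew_scalM skew_scal_central.

Lemma skewU_scal c : skewU a (scal c) 0 = scal c. Proof. by []. Qed.

Lemma skewU0_morphism : alg_morphism (skewU a ^~ 0).
Proof.
split=> [c|r s|r s]; [exact: skewU_scal|exact: skewUD|].
by rewrite skew_mulUU act0 addr0.
Qed.

Lemma skew_mul_scalU c r k : scal c * skewU a r k = skewU a (scal c * r) k.
Proof. by rewrite -skewU_scal skew_mulUU act0 add0r. Qed.

Lemma mcoeff_skewUl r k (x : S) l : (skewU a r k * x)@_(k + l) = r * a k x@_l.
Proof.
elim/skew_ind: x => [|x y IHx IHy|s m]; first by rewrite mulr0 !mcoeff0 raddf0 mulr0.
  by rewrite mulrDr !mcoeffD IHx IHy raddfD mulrDr.
rewrite skew_mulUU !mcoeff_skewU (inj_eq (addrI k)).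
by case: eqP => _; rewrite ?mulr1n // !mulr0n raddf0 mulr0.
Qed.

Lemma mcoeff_skewU0l r (x : S) k : (skewU a r 0 * x)@_k = r * x@_k.
Proof. by have := mcoeff_skewUl r 0 x k; rewrite add0r act0. Qed.

Lemma mcoeff_skewU0r s (x : S) k : (x * skewU a s 0)@_k = x@_k * a k s.
Proof.
elim/skew_ind: x => [|x y IHx IHy|r l]; first by rewrite mul0r mcoeff0 mul0r.
  by rewrite mulrDl !mcoeffD IHx IHy mulrDl.
by rewrite skew_mulUU addr0 !mcoeff_skewU; case: eqP => [->|_]; rewrite ?mul0r.
Qed.

Lemma skewU0_commP s (x : S) :
  x * skewU a s 0 = skewU a s 0 * x <-> forall k, x@_k * a k s = s * x@_k.
Proof.
split=> [xs k|xs]; first by rewrite -mcoeff_skewU0r xs mcoeff_skewU0l.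
by apply/malgP => k; rewrite mcoeff_skewU0r mcoeff_skewU0l.
Qed.

Lemma lreg_skewU r k : GRing.lreg r -> GRing.lreg (skewU a r k).
Proof.
move=> r_reg; apply: mulrI0_lreg => x rx0; apply/malgP => l.
apply: (can_inj (actK a k)); rewrite mcoeff0 raddf0; apply: r_reg.
by rewrite mulr0 -mcoeff_skewUl rx0 mcoeff0.
Qed.

Lemma skew_prodU (I : Type) (c : I -> R) (d : I -> G) (s : seq I) :
  exists r, \prod_(i <- s) skewU a (c i) (d i) = skewU a r (\sum_(i <- s) d i).
Proof.
elim: s => [|i s [r IHs]]; first by exists 1; rewrite !big_nil skewU10.
by eexists; rewrite !big_cons IHs skew_mulUU.
Qed.
End SkewRing.

Section SkewPushforward.
Variables (K : comPzRingType) (R : pzAlgType K) (G H : zmodType).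
Variables (a : alg_action G R) (f : {additive H -> G}).
Local Notation af := (act_pullback a f).

Definition skew_push : skew_ring af -> skew_ring a :=
  malg_lift (fun k => mkmalgU (f k) : {additive R -> {malg R[G]}}).

Lemma skew_pushU r k : skew_push (skewU af r k) = skewU a r (f k).
Proof. by rewrite !skewU.unlock; exact: malg_liftU. Qed.

Lemma skew_push_morphism : alg_morphism skew_push.
Proof.
have pushD : {morph skew_push : x y / x + y} by exact: raddfD.
have push0 : skew_push 0 = 0 by exact: raddf0.
split=> // [c|x y]; first by rewrite -!skewU_scal skew_pushU raddf0.
elim/skew_ind: x => [|x x' IHx IHx'|r k]; first by rewrite mul0r push0 mul0r.
  by rewrite mulrDl !pushD mulrDl IHx IHx'.
elim/skew_ind: y => [|y y' IHy IHy'|s l]; first by rewrite mulr0 push0 mulr0.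
  by rewrite mulrDr !pushD mulrDr IHy IHy'.
by rewrite skew_mulUU !skew_pushU skew_mulUU raddfD.
Qed.

Lemma skew_push_inj : injective f -> injective skew_push.
Proof.
move=> f_inj; have pushE x k : (skew_push x)@_(f k) = x@_k.
  rewrite /skew_push /malg_lift /= mcoeff_sumU //.
  by case: msuppP => // _; rewrite mulr0n.
by move=> x y xy; apply/malgP => k; rewrite -!pushE xy.
Qed.
End SkewPushforward.

(** * Embedding a TGW algebra into a skew group ring *)

Record tgw_family (K : comNzRingType) (R : pzAlgType K) (I : choiceType)
    (D : tgw_datum R I) (mu : I -> I -> K) (A : pzAlgType K)
    (r_ : R -> A) (X_ Y_ : I -> A) : Prop := TgwFamily {
  tgw_r_morphism : alg_morphism r_;
  tgw_Xr : forall i r, X_ i * r_ r = r_ (tgw_sigma D i r) * X_ i;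
  tgw_Yr : forall i r, Y_ i * r_ r = r_ (tgw_sigmaV D i r) * Y_ i;
  tgw_YX : forall i, Y_ i * X_ i = r_ (tgw_t D i);
  tgw_XY : forall i, X_ i * Y_ i = r_ (tgw_sigma D i (tgw_t D i));
  tgw_XYC : forall i j, i != j -> X_ i * Y_ j = scal (mu i j) * (Y_ j * X_ i)
}.

Definition tgw_gen (K : comNzRingType) (R : pzAlgType K) (I : choiceType) (A : pzAlgType K)
    (r_ : R -> A) (X_ Y_ : I -> A) (g : R + I + I) : A :=
  match g with inl (inl r) => r_ r | inl (inr i) => X_ i | inr i => Y_ i end.

Lemma tgw_gen_rel (K : comNzRingType) (R : pzAlgType K) (I : choiceType)
    (D : tgw_datum R I) (mu : I -> I -> K) (A : pzAlgType K) r_ X_ Y_ f g :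
  @tgw_family K R I D mu A r_ X_ Y_ -> tgw_rel D mu f g ->
  free_eval (tgw_gen r_ X_ Y_) f = free_eval (tgw_gen r_ X_ Y_) g.
Proof.
move=> [r_morph Xr Yr YX XY XYC].
have ev_morph := free_eval_morphism (tgw_gen r_ X_ Y_); have evM := alg_morphM ev_morph.
case=> [c|r s|r s|i r|i r|i|i|i j ij].
- by rewrite free_eval_gen (alg_morph_scal ev_morph) /= (alg_morph_scal r_morph).
- by rewrite [RHS](alg_morphD ev_morph) !free_eval_gen /= (alg_morphD r_morph).
- by rewrite [RHS]evM !free_eval_gen /= (alg_morphM r_morph).
- by rewrite [LHS]evM [RHS]evM !free_eval_gen; exact: Xr.
- by rewrite [LHS]evM [RHS]evM !free_eval_gen; exact: Yr.
- by rewrite [LHS]evM !free_eval_gen; exact: YX.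
- by rewrite [LHS]evM !free_eval_gen; exact: XY.
rewrite [LHS]evM [RHS]evM (evM (Ygen R j)) !free_eval_gen (alg_morph_scal ev_morph).
exact: XYC.
Qed.

Section TgwDegreeZero.
Variables (K : comUnitRingType) (R : pzAlgType K) (I : choiceType).
Variables (D : tgw_datum R I) (mu : I -> I -> K) (A : pzAlgType K).
Variables (r_ : R -> A) (X_ Y_ : I -> A).
Hypotheses (rXY : tgw_family D mu r_ X_ Y_) (mu_unit : forall i j, mu i j \is a GRing.unit).
Local Notation Gen := (R + I + I)%type.
Local Notation Xs s := (\prod_(i <- s) X_ i).
Local Notation Ys s := (\prod_(i <- s) Y_ i).

Let r1 : r_ 1 = 1. Proof. exact: alg_morph1 (tgw_r_morphism rXY). Qed.
Let rM : {morph r_ : r s / r * s}. Proof. exact: alg_morphM (tgw_r_morphism rXY). Qed.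
Let r_scal c : r_ (scal c) = scal c. Proof. exact: alg_morph_scal (tgw_r_morphism rXY) c. Qed.

Lemma tgw_YXC i j : i != j -> Y_ j * X_ i = scal (mu i j)^-1 * (X_ i * Y_ j).
Proof. by move=> ij; rewrite (tgw_XYC rXY) // [RHS]mulrA -scalM mulVr // scal1 mul1r. Qed.

Lemma tgw_Ys_r s r : exists r', Ys s * r_ r = r_ r' * Ys s.
Proof.
elim: s r => [|i s IHs] r; first by exists r; rewrite big_nil mul1r mulr1.
by rewrite big_cons -mulrA; have [r' ->] := IHs r; rewrite mulrA (tgw_Yr rXY) -mulrA; eexists.
Qed.

Lemma tgw_X_Ys i s : exists r,
  X_ i * Ys s = r_ r * (if i \in s then Ys (rem i s) else Ys s * X_ i).
Proof.
elim: s => [|j s [r IHs]]; first by exists 1; rewrite big_nil r1 mulr1 !mul1r.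
rewrite big_cons /= in_cons eq_sym; case: eqP => [->|/eqP ji] /=.
  by eexists; rewrite mulrA (tgw_XY rXY).
exists (scal (mu i j) * tgw_sigmaV D j r).
rewrite mulrA (tgw_XYC rXY) 1?eq_sym // -[LHS]mulrA -(mulrA _ (X_ i)) IHs rM r_scal.
rewrite -[RHS]mulrA; congr (_ * _); rewrite mulrA (tgw_Yr rXY) -[LHS]mulrA; congr (_ * _).
by case: ifP => _; rewrite ?big_cons // mulrA.
Qed.

Lemma tgw_Y_Xs i s : i \in s -> exists r, Y_ i * Xs s = r_ r * Xs (rem i s).
Proof.
elim: s => [//|j s IHs]; rewrite in_cons eq_sym big_cons /=.
case: eqP => [-> _|/eqP ji /= /IHs[r {}IHs]]; first by eexists; rewrite mulrA (tgw_YX rXY).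
exists (scal (mu j i)^-1 * tgw_sigma D j r).
rewrite mulrA tgw_YXC // -[LHS]mulrA -(mulrA _ (Y_ i)) IHs rM r_scal -[RHS]mulrA; congr (_ * _).
by rewrite mulrA (tgw_Xr rXY) -mulrA big_cons.
Qed.

Lemma tgw_Ys_Xs_perm s t : perm_eq s t -> exists r, Ys s * Xs t = r_ r.
Proof.
elim/last_ind: s t => [|s i IHs] t st.
  have -> : t = [::] by apply/perm_nilP; rewrite perm_sym.
  by exists 1; rewrite !big_nil mulr1 r1.
have it : i \in t by rewrite -(perm_mem st) mem_rcons mem_head.
have {}st : perm_eq s (rem i t).
  by rewrite -(perm_cons i) -(perm_rcons i s); apply: perm_trans st (perm_to_rem it).
rewrite big_rcons -mulrA; have [r ->] := tgw_Y_Xs it.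
rewrite mulrA; have [r' ->] := tgw_Ys_r s r.
by rewrite -mulrA; have [r'' ->] := IHs _ st; exists (r' * r''); rewrite rM.
Qed.

Lemma tgw_normal_form (s : seq Gen) : exists r ys xs,
  \prod_(g <- s) tgw_gen r_ X_ Y_ g = r_ r * (Ys ys * Xs xs) /\
  \sum_(g <- s) gen_deg g + \sum_(i <- ys) << i >> = \sum_(i <- xs) << i >> :> {malg I}.
Proof.
elim: s => [|g s [r [ys [xs [IHs deg_s]]]]].
  by exists 1, [::], [::]; rewrite !big_nil !mulr1 r1 addr0.
rewrite !big_cons IHs; case: g => [[r'|i]|i] /=.
- by exists (r' * r), ys, xs; rewrite add0r rM !mulrA.
- rewrite (mulrA (X_ i)) (tgw_Xr rXY) -[_ * X_ i * _]mulrA (mulrA (X_ i)).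
  have [r' ->] := tgw_X_Ys i ys; exists (tgw_sigma D i r * r'); case: ifP => iys.
    exists (rem i ys), xs; rewrite rM !mulrA; split=> //.
    by rewrite -deg_s (big_rem i iys) /= -addrA addrCA.
  by exists ys, (i :: xs); rewrite rM !big_cons !mulrA -addrA deg_s.
- rewrite (mulrA (Y_ i)) (tgw_Yr rXY) -[_ * Y_ i * _]mulrA (mulrA (Y_ i)).
  exists (tgw_sigmaV D i r), (i :: ys), xs; rewrite !big_cons mulrA; split=> //.
  by rewrite addrACA addNr add0r.
Qed.

Lemma tgw_word_deg0 (s : seq Gen) : \sum_(g <- s) gen_deg g = 0 :> {malg I} ->
  exists r, \prod_(g <- s) tgw_gen r_ X_ Y_ g = r_ r.
Proof.
have [r [ys [xs [-> deg_s]]]] := tgw_normal_form s; move=> s0.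
have sumE (t : seq I) i : (\sum_(j <- t) << j >> : {malg I})@_i = (count_mem i t)%:Z.
  rewrite raddf_sum /=; elim: t => [|j t IHt]; first by rewrite big_nil.
  by rewrite big_cons IHt mcoeffU /= PoszD; case: eqP.
have /tgw_Ys_Xs_perm[r' ->] : perm_eq ys xs.
  rewrite /perm_eq; apply/allP => i _ /=; apply/eqP.
  by have /(congr1 (mcoeff i)) := deg_s; rewrite s0 add0r !sumE => -[].
by exists (r * r'); rewrite rM.
Qed.
End TgwDegreeZero.

Section TgwGrading.
Variables (K : comNzRingType) (R : pzAlgType K) (I : choiceType).
Variables (D : tgw_datum R I) (mu : I -> I -> K).
Local Notation C := (tgw_C D mu).

Definition tgwC_pi : tgw_free R I -> C := quot_pi _.
Definition tgwC_r (r : R) : C := tgwC_pi (rgen I r).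
Definition tgwC_X (i : I) : C := tgwC_pi (Xgen R i).
Definition tgwC_Y (i : I) : C := tgwC_pi (Ygen R i).
Local Notation tgwC_gen := (tgw_gen tgwC_r tgwC_X tgwC_Y).

Lemma tgwC_pi_morphism : alg_morphism tgwC_pi.
Proof. exact: quot_pi_morphism. Qed.

Lemma tgwC_pi_gen g : tgwC_pi (free_gen K g) = tgwC_gen g.
Proof. by case: g => [[r|i]|i]. Qed.

Lemma tgwC_piE f : tgwC_pi f = free_eval tgwC_gen f.
Proof.
rewrite -[f in LHS]free_eval_id (alg_morphism_free_eval _ _ tgwC_pi_morphism).
by rewrite (funext tgwC_pi_gen : _ \o _ = tgwC_gen).
Qed.

Lemma tgwC_family : tgw_family D mu tgwC_r tgwC_X tgwC_Y.
Proof.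
have piM := alg_morphM tgwC_pi_morphism.
split=> [|i r|i r|i|i|i j ij].
- split=> [c|r s|r s]; first exact: (presented_rel (rel_scal D mu c)).
  + by rewrite -(alg_morphD tgwC_pi_morphism); exact: (presented_rel (rel_add D mu r s)).
  + by rewrite -piM; exact: (presented_rel (rel_mul D mu r s)).
- by rewrite -[LHS]piM -[RHS]piM; exact: (presented_rel (rel_Xr D mu i r)).
- by rewrite -[LHS]piM -[RHS]piM; exact: (presented_rel (rel_Yr D mu i r)).
- by rewrite -[LHS]piM; exact: (presented_rel (rel_YX D mu i)).
- by rewrite -[LHS]piM; exact: (presented_rel (rel_XY D mu i)).
transitivity (tgwC_pi (scal (mu i j) * (Ygen R j * Xgen R i))).
  by rewrite -[LHS]piM; exact: (presented_rel (rel_XYC D mu ij)).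
by apply: (etrans (piM _ _)); rewrite (alg_morph_scal tgwC_pi_morphism) (piM (Ygen R j)).
Qed.

Lemma tgw_C_homogM c c' d d' :
  tgw_C_homog d c -> tgw_C_homog d' c' -> @tgw_C_homog _ _ _ D mu (d + d') (c * c').
Proof.
move=> [f f_deg ->] [g g_deg ->]; exists (f * g); last by rewrite quot_piM.
move=> w /msuppM_le /= [v [v' [vf v'g ->]]].
by rewrite /word_deg fmM big_cat -(f_deg v vf) -(g_deg v' v'g).
Qed.

Lemma tgw_C_homog_pi d w c : word_deg w = d -> @tgw_C_homog _ _ _ D mu d (tgwC_pi << c *g w >>).
Proof. by move=> wd; exists << c *g w >> => // v /(fsubsetP msuppU_le); rewrite inE => /eqP ->. Qed.

Lemma tgw_C_homog_gen g : tgw_C_homog (gen_deg g) (tgwC_gen g).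
Proof. by rewrite -tgwC_pi_gen; apply: tgw_C_homog_pi; rewrite /word_deg fmU big_seq1. Qed.

Lemma tgw_C_homog1 : @tgw_C_homog _ _ _ D mu 0 1.
Proof.
rewrite -(alg_morph1 tgwC_pi_morphism).
by apply: tgw_C_homog_pi; rewrite /word_deg fm1 big_nil.
Qed.

Lemma tgw_C_homog_decomp (c : C) : exists (s : {fset {malg I}}) (part : {malg I} -> C),
  (forall d, tgw_C_homog d (part d)) /\ c = \sum_(d <- s) part d.
Proof.
pose f := quot_repr c; pose part d := \sum_(w <- msupp f | word_deg w == d) << f@_w *g w >>.
exists [fset word_deg w | w in msupp f]%fset, (fun d => tgwC_pi (part d)); split=> [d|].
  exists (part d) => // w; rewrite -mcoeff_neq0; apply: contra_neq_eq => wd.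
  rewrite raddf_sum big1 //= => v /eqP vd; rewrite mcoeffU.
  by case: eqP => // vw; rewrite -vw vd eqxx in wd.
rewrite -(alg_morph_sum tgwC_pi_morphism) -(partition_big_imfset _ (@word_deg K R I)).
by rewrite -monalgE /tgwC_pi quot_reprK.
Qed.
End TgwGrading.

Lemma tgw_C_homog0_r (K : comUnitRingType) (R : pzAlgType K) (I : choiceType)
    (D : tgw_datum R I) (mu : I -> I -> K) (c : tgw_C D mu) :
  (forall i j, mu i j \is a GRing.unit) -> tgw_C_homog 0 c -> exists r, c = tgwC_r D mu r.
Proof.
move=> mu_unit [f f_deg0 ->]; rewrite -[quot_pi _ f]/(tgwC_pi D mu f) tgwC_piE /free_eval big_seq.
have r_morph := tgw_r_morphism (tgwC_family D mu).
apply: (big_ind (fun c => exists r, c = tgwC_r D mu r)) => [|_ _ [r ->] [s ->]|w /f_deg0].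
- by exists 0; rewrite (alg_morph0 r_morph).
- by exists (r + s); rewrite (alg_morphD r_morph).
move=> /(tgw_word_deg0 (tgwC_family D mu) mu_unit)[r ->]; exists (scal f@_w * r).
by rewrite (alg_morphM r_morph) (alg_morph_scal r_morph).
Qed.

(* Such a realization sends [X_i] to [cX_i T^i] and [Y_i] to [cY_i T^(-i)] in
   the skew group ring [R # ZI]. *)
Record skew_realization (K : comNzRingType) (R : pzAlgType K) (I : choiceType)
    (D : tgw_datum R I) (mu : I -> I -> K) := SkewRealization {
  sr_act : alg_action {malg I} R;
  sr_cX : I -> R;
  sr_cY : I -> R;
  sr_actU : forall i r, sr_act << i >> r = tgw_sigma D i r;
  sr_cX_central : forall i r, sr_cX i * r = r * sr_cX i;
  sr_cY_central : forall i r, sr_cY i * r = r * sr_cY i;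
  sr_cX_lreg : forall i, GRing.lreg (sr_cX i);
  sr_cY_lreg : forall i, GRing.lreg (sr_cY i);
  sr_cYX : forall i, sr_cY i * sr_act (- << i >>) (sr_cX i) = tgw_t D i;
  sr_cXYC : forall i j, i != j -> sr_cX i * sr_act << i >> (sr_cY j) =
    scal (mu i j) * (sr_cY j * sr_act (- << j >>) (sr_cX i))
}.

Section TgwEmbedding.
Variables (K : comUnitRingType) (R : pzAlgType K) (I : choiceType).
Variables (D : tgw_datum R I) (mu : I -> I -> K) (F : skew_realization D mu).
Local Notation C := (tgw_C D mu).
Local Notation S := (skew_ring (sr_act F)).
Local Notation tgwC_gen := (tgw_gen (tgwC_r D mu) (tgwC_X D mu) (tgwC_Y D mu)).

Definition sr_r (r : R) : S := skewU (sr_act F) r 0.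
Definition sr_X (i : I) : S := skewU (sr_act F) (sr_cX F i) << i >>.
Definition sr_Y (i : I) : S := skewU (sr_act F) (sr_cY F i) (- << i >>).
Local Notation sr_gen := (tgw_gen sr_r sr_X sr_Y).

Lemma sr_genE g :
  sr_gen g = skewU (sr_act F) (tgw_gen id (sr_cX F) (sr_cY F) g) (gen_deg g).
Proof. by case: g => [[r|i]|i]. Qed.

Lemma tgw_sigmaV_act i r : tgw_sigmaV D i r = sr_act F (- << i >>) r.
Proof. by rewrite -[r in LHS](actK (sr_act F) (- << i >>)) opprK (sr_actU F) tgw_sigmaK. Qed.

Lemma sr_cXY i : sr_cX F i * sr_act F << i >> (sr_cY F i) = tgw_sigma D i (tgw_t D i).
Proof. by rewrite -(sr_actU F) -(sr_cYX F) rmorphM /= -actD subrr act0 sr_cX_central. Qed.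

Lemma sr_family : tgw_family D mu sr_r sr_X sr_Y.
Proof.
split=> [|i r|i r|i|i|i j ij].
- exact: skewU0_morphism.
- by rewrite [LHS]skew_mulUU [RHS]skew_mulUU (sr_actU F) addr0 add0r act0 sr_cX_central.
- by rewrite [LHS]skew_mulUU [RHS]skew_mulUU -tgw_sigmaV_act addr0 add0r act0 sr_cY_central.
- by rewrite [LHS]skew_mulUU addNr sr_cYX.
- by rewrite [LHS]skew_mulUU subrr sr_cXY.
rewrite [LHS]skew_mulUU (sr_cXYC F ij) -skew_mul_scalU [sr_Y j * _]skew_mulUU.
by rewrite [- << j >> + _]addrC.
Qed.

Lemma sr_gen_rel f g : tgw_rel D mu f g -> free_eval sr_gen f = free_eval sr_gen g.
Proof. exact: tgw_gen_rel sr_family. Qed.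

Definition tgwC_skew : C -> S := presented_eval sr_gen.

Lemma tgwC_skew_morphism : alg_morphism tgwC_skew.
Proof. exact: (presented_eval_morphism sr_gen_rel). Qed.

Lemma tgwC_skew_gen g : tgwC_skew (tgwC_gen g) = sr_gen g.
Proof. by rewrite -tgwC_pi_gen; exact: (presented_eval_gen sr_gen_rel). Qed.

Lemma tgwC_skew_homog d c : tgw_C_homog d c -> exists r, tgwC_skew c = skewU (sr_act F) r d.
Proof.
move=> [f f_deg ->]; rewrite /tgwC_skew (presented_eval_pi sr_gen_rel).
rewrite /free_eval big_seq; apply: (big_ind (fun x : S => exists r, x = skewU (sr_act F) r d)).
- by exists 0; rewrite skewU0.
- by move=> _ _ [r ->] [s ->]; exists (r + s); rewrite skewUD.
move=> w /f_deg <-.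
rewrite (eq_bigr _ (fun g _ => sr_genE g)).
have [r ->] := skew_prodU (sr_act F) (tgw_gen id (sr_cX F) (sr_cY F)) (@gen_deg K R I) w.
by exists (scal f@_w * r); rewrite skew_mul_scalU.
Qed.

Lemma tgwC_skew_monomial d : exists c,
  tgw_C_homog d c /\ exists2 r, GRing.lreg r & tgwC_skew c = skewU (sr_act F) r d.
Proof.
elim/malg_int_ind: d => [|d e [c [cd [r r_reg cE]]] [c' [c'e [s s_reg c'E]]]|i|i].
- exists 1; split; first exact: tgw_C_homog1.
  by exists 1; [exact: lreg1|exact: alg_morph1 tgwC_skew_morphism].
- exists (c * c'); split; first exact: tgw_C_homogM.
  exists (r * sr_act F d s); first by apply: lregM => //; exact: lreg_act.
  by rewrite (alg_morphM tgwC_skew_morphism) cE c'E; exact: skew_mulUU.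
- exists (tgwC_X D mu i); split; first exact: (tgw_C_homog_gen D mu (inl (inr i))).
  by exists (sr_cX F i); [exact: sr_cX_lreg|exact: (tgwC_skew_gen (inl (inr i)))].
- exists (tgwC_Y D mu i); split; first exact: (tgw_C_homog_gen D mu (inr i)).
  by exists (sr_cY F i); [exact: sr_cY_lreg|exact: (tgwC_skew_gen (inr i))].
Qed.

(* A homogeneous element of an ideal meeting degree zero trivially is killed by
   a regular monomial of the opposite degree. *)
Lemma tgw_radical_skew c : tgw_radical D mu c -> tgwC_skew c = 0.
Proof.
move=> [s s_ideal ->]; rewrite (alg_morph_sum tgwC_skew_morphism) big1_seq // => x /= xs.
have {s s_ideal xs} [J [J_graded J_deg0] /J_graded[s s_homog ->]] := s_ideal x xs.
rewrite (alg_morph_sum tgwC_skew_morphism) big1_seq // => y /= /s_homog[Jy [d yd]].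
have [m [m_deg [r r_reg mE]]] := tgwC_skew_monomial (- d).
have my0 : m * y = 0.
  apply: J_deg0; first by rewrite -[m * y]mulr1; exact: idealM.
  by rewrite -(addNr d); exact: tgw_C_homogM.
apply: (lreg_skewU (a := sr_act F) (k := - d) r_reg); rewrite -mE.
by rewrite -(alg_morphM tgwC_skew_morphism) my0 mulr0 (alg_morph0 tgwC_skew_morphism).
Qed.

Hypothesis mu_unit : forall i j, mu i j \is a GRing.unit.

Lemma skew_tgw_radical c : tgwC_skew c = 0 -> tgw_radical D mu c.
Proof.
move=> c0; exists [:: c]; last by rewrite big_seq1.
move=> _ /[1!inE] /eqP ->; exists (ker_ideal tgwC_skew_morphism) => //; split=> /= x x0.
  have [s [part [part_homog xE]]] := tgw_C_homog_decomp x.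
  exists [seq part d | d <- s]; last by rewrite big_map.
  move=> _ /mapP[d ds ->]; split; last by exists d.
  have [coef coefE] := choice (fun d => tgwC_skew_homog (part_homog d)).
  have := congr1 (mcoeff d) x0; rewrite xE (alg_morph_sum tgwC_skew_morphism).
  rewrite (eq_bigr _ (fun d _ => coefE d)) mcoeff_sum_skewU ds mulr1n mcoeff0.
  by move=> coef0; apply: etrans (coefE d) _; rewrite coef0 skewU0.
move=> /(tgw_C_homog0_r mu_unit)[r xE]; move: x0.
rewrite xE (tgwC_skew_gen (inl (inl r))) => /(congr1 (mcoeff 0)).
rewrite mcoeff_skewU eqxx mcoeff0 mulr1n => ->.
exact: alg_morph0 (tgw_r_morphism (tgwC_family D mu)).
Qed.

Definition tgw_skew (x : tgw D mu) : S := quot_lift tgwC_skew x.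

Lemma tgw_skew_morphism : alg_morphism tgw_skew.
Proof. exact: (quot_lift_morphism tgwC_skew_morphism tgw_radical_skew). Qed.

Lemma tgw_skew_inj : injective tgw_skew.
Proof. exact: (quot_lift_inj tgwC_skew_morphism tgw_radical_skew skew_tgw_radical). Qed.

Lemma tgw_skewE x : tgw_skew x = free_eval sr_gen (quot_repr (quot_repr x)).
Proof. by rewrite /tgw_skew /tgwC_skew /presented_eval quot_lift.unlock. Qed.

Lemma tgw_skew_r r : tgw_skew (tgw_r D mu r) = skewU (sr_act F) r 0.
Proof.
rewrite /tgw_skew (quot_lift_pi tgwC_skew_morphism tgw_radical_skew).
exact: (tgwC_skew_gen (inl (inl r))).
Qed.

Lemma tgw_skew_monomial d : exists x r, GRing.lreg r /\ tgw_skew x = skewU (sr_act F) r d.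
Proof.
have [c [_ [r r_reg cE]]] := tgwC_skew_monomial d; exists (quot_pi _ c), r; split=> //.
by rewrite /tgw_skew (quot_lift_pi tgwC_skew_morphism tgw_radical_skew).
Qed.
End TgwEmbedding.

(** * The Weyl algebra *)

Section ShiftAction.
Variables (K : comNzRingType) (E : choiceType).
Local Notation P := (poly_alg K E).
Local Notation u := (@poly_var K E).

Definition shift_var (k : {malg E}) (e : E) : P := u e - (k@_e)%:~R.

Let shift_eval_comp k (h : E -> P) p :
  poly_eval (shift_var k) (poly_eval h p) = poly_eval (poly_eval (shift_var k) \o h) p.
Proof. exact: alg_morph_poly_eval (poly_eval_morphism _). Qed.

Fact shift_eval0 p : poly_eval (shift_var 0) p = p.
Proof.
rewrite -[RHS]poly_eval_id; congr (poly_eval _ p); apply/funext => e.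
by rewrite /shift_var mcoeff0 subr0.
Qed.

Fact shift_evalD k l p :
  poly_eval (shift_var (k + l)) p = poly_eval (shift_var k) (poly_eval (shift_var l) p).
Proof.
rewrite shift_eval_comp; congr (poly_eval _ p); apply/funext => e /=.
have ev_morph := poly_eval_morphism (shift_var k).
rewrite /shift_var (alg_morphB ev_morph) poly_eval_var (alg_morph_int ev_morph).
by rewrite /shift_var mcoeffD rmorphD opprD addrA.
Qed.
End ShiftAction.

(* Locked, since unification would otherwise unfold polynomial evaluations. *)
HB.lock Definition shift_action (K : comNzRingType) (E : choiceType) :
    alg_action {malg E} (poly_alg K E) :=
  AlgAction (fun k => poly_eval_morphism (shift_var K k))
    (@shift_eval0 K E) (@shift_evalD K E).

Section ShiftTheory.
Variables (K : comNzRingType) (E : choiceType).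
Local Notation u := (@poly_var K E).
Local Notation shift := (shift_action K E).

Lemma shift_actionE k p : shift k p = poly_eval (shift_var K k) p.
Proof. by rewrite shift_action.unlock. Qed.

Lemma shift_action_var k e : shift k (u e) = u e - (k@_e)%:~R.
Proof. by rewrite shift_actionE poly_eval_var. Qed.

Lemma lreg_poly_var e : GRing.lreg (u e).
Proof.
apply: mulrI0_lreg => p up0; apply/malgP => m; rewrite mcoeff0.
have := congr1 (mcoeff (mmul (ucm e) m)) up0; rewrite mcoeff0 => <-.
rewrite malgM_def fgmulUg raddf_sum /= [in LHS](monalgE p) raddf_sum /=.
apply: eq_bigr => l _; rewrite !mcoeffU mul1r; congr (_ *+ nat_of_bool _).
apply/eqP/eqP => [->//|/eqP/cmP eq_m]; apply/eqP/cmP => i.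
by have := eq_m i; rewrite !cmM => /addnI.
Qed.

Lemma lreg_poly_varD e (z : int) : GRing.lreg (u e + z%:~R).
Proof.
have -> : u e + z%:~R = shift << - z *g e >> (u e).
  by rewrite shift_action_var mcoeffUU rmorphN opprK.
exact/lreg_act/lreg_poly_var.
Qed.
End ShiftTheory.

Definition weyl_family (K : comNzRingType) (E : choiceType) (B : pzAlgType K)
    (x y : E -> B) : Prop :=
  [/\ forall e f, x e * x f = x f * x e,
      forall e f, y e * y f = y f * y e
    & forall e f, y e * x f = x f * y e + (e == f)%:R].

Definition weyl_gen (B E : Type) (x y : E -> B) (g : E + E) : B :=
  match g with inl e => x e | inr e => y e end.

Lemma weyl_gen_rel (K : comNzRingType) (E : choiceType) (B : pzAlgType K) (x y : E -> B) f g :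
  weyl_family x y -> weyl_rel f g ->
  free_eval (weyl_gen x y) f = free_eval (weyl_gen x y) g.
Proof.
move=> [xx yy yx]; set h := weyl_gen x y; have h_morph := free_eval_morphism h.
have h_bracket s t : free_eval h (free_gen K s * free_gen K t - free_gen K t * free_gen K s) =
    h s * h t - h t * h s.
  have hM s' t' : free_eval h (free_gen K s' * free_gen K t') = h s' * h t'.
    by apply: etrans (alg_morphM h_morph _ _) _; congr (_ * _); exact: free_eval_gen.
  by apply: etrans (alg_morphB h_morph _ _) _; congr (_ - _); exact: hM.
case=> e e'; apply: (etrans (h_bracket _ _)); rewrite /h /= ?(alg_morph0 h_morph).
- by rewrite xx subrr.
- by rewrite yy subrr.
rewrite yx addrAC subrr add0r.
by case: (e == e'); rewrite ?(alg_morph1 h_morph) ?(alg_morph0 h_morph).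
Qed.

Lemma weyl_xy_family (K : comNzRingType) (E : choiceType) :
  weyl_family (@weyl_x K E) (@weyl_y K E).
Proof.
have pi_bracket (g g' : E + E) (c : weyl_free K E) :
    weyl_rel (free_gen K g * free_gen K g' - free_gen K g' * free_gen K g) c ->
    quot_pi _ (free_gen K g) * quot_pi _ (free_gen K g') =
    quot_pi _ (free_gen K g') * quot_pi _ (free_gen K g) + quot_pi _ c :> weyl K E.
  move=> /presented_rel <-; rewrite -!quot_piM -quot_piD.
  by rewrite addrC subrK.
have pi_morph := presented_pi_morphism (@weyl_rel K E).
split=> e f.
- by apply: etrans (pi_bracket _ _ _ (weyl_xx K e f)) _; rewrite (alg_morph0 pi_morph) addr0.
- by apply: etrans (pi_bracket _ _ _ (weyl_yy K e f)) _; rewrite (alg_morph0 pi_morph) addr0.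
- apply: etrans (pi_bracket _ _ _ (weyl_yx K e f)) _; congr (_ + _).
  by case: (e == f); rewrite ?(alg_morph1 pi_morph) ?(alg_morph0 pi_morph).
Qed.

Section WeylMonomials.
Variables (E : choiceType) (B : pzRingType) (x y : E -> B).

Definition zpow (e : E) (p : int) : B :=
  if 0 <= p then x e ^+ `|p|%N else y e ^+ `|p|%N.

Definition zmon (k : {malg E}) : B := \prod_(e <- msupp k) zpow e k@_e.
End WeylMonomials.

Lemma alg_morph_zmon (K : comNzRingType) (E : choiceType) (A B : pzAlgType K) (f : A -> B)
    (x y : E -> A) k :
  alg_morphism f -> f (zmon x y k) = zmon (f \o x) (f \o y) k.
Proof.
move=> f_morph; rewrite (alg_morph_prod f_morph); apply: eq_bigr => e _.
by rewrite /zpow; case: ifP => _; rewrite (alg_morphX f_morph).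
Qed.

Section WeylNormalForm.
Variables (K : comNzRingType) (E : choiceType) (B : pzAlgType K) (x y : E -> B).
Hypothesis xy_weyl : weyl_family x y.
Local Notation P := (poly_alg K E).
Local Notation u := (@poly_var K E).
Local Notation shift := (shift_action K E).
Local Notation z := (zmon x y).

Let xx e f : x e * x f = x f * x e. Proof. by case: xy_weyl. Qed.
Let yy e f : y e * y f = y f * y e. Proof. by case: xy_weyl. Qed.
Let yx e f : y e * x f = x f * y e + (e == f)%:R. Proof. by case: xy_weyl. Qed.
Let xy e f : e != f -> x e * y f = y f * x e.
Proof. by move=> ef; rewrite yx eq_sym (negbTE ef) addr0. Qed.
Let xye e : x e * y e = y e * x e - 1.
Proof. by rewrite yx eqxx addrK. Qed.

Definition weyl_ev : P -> B := poly_eval (fun e => y e * x e).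

Lemma weyl_ev_morphism : alg_morphism weyl_ev.
Proof.
apply: comm_poly_eval_morphism => e f; have [-> //|ef] := eqVneq e f.
rewrite /GRing.comm -mulrA [x e * _]mulrA xy // -mulrA [x e * _]xx mulrA yy -!mulrA.
by congr (_ * _); rewrite !mulrA; congr (_ * _); rewrite xy // eq_sym.
Qed.

HB.instance Definition _ := GRing.isZmodMorphism.Build P B weyl_ev
  (alg_morphB weyl_ev_morphism).

HB.instance Definition _ := GRing.isMonoidMorphism.Build P B weyl_ev
  (alg_morph1 weyl_ev_morphism, alg_morphM weyl_ev_morphism).

Lemma weyl_ev_scal c : weyl_ev (scal c) = scal c.
Proof. exact: alg_morph_scal weyl_ev_morphism c. Qed.

Lemma weyl_ev_var e : weyl_ev (u e) = y e * x e.
Proof.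
exact: (@comm_poly_eval_var K E B (fun e => y e * x e)).
Qed.

Lemma weyl_ev_var_sub1 e : weyl_ev (u e - 1) = x e * y e.
Proof.
rewrite xye; apply: etrans (alg_morphB weyl_ev_morphism _ _) _.
by congr (_ - _); [exact: weyl_ev_var|exact: alg_morph1 weyl_ev_morphism].
Qed.

Lemma weyl_ev_var_add1 e : weyl_ev (u e + 1) = y e * x e + 1.
Proof.
apply: etrans (alg_morphD weyl_ev_morphism _ _) _.
by congr (_ + _); [exact: weyl_ev_var|exact: alg_morph1 weyl_ev_morphism].
Qed.

Lemma weyl_x_ev e p : x e * weyl_ev p = weyl_ev (shift << e >> p) * x e.
Proof.
elim/poly_alg_ind: p => [c|f|p q IHp IHq|p q IHp IHq].
- by rewrite act_scal weyl_ev_scal scal_central.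
- rewrite shift_action_var mcoeffU; case: eqP => [<-|/eqP ef].
    by rewrite weyl_ev_var_sub1 weyl_ev_var mulrA.
  by rewrite subr0 weyl_ev_var mulrA xy // -!mulrA [x e * _]xx.
- by rewrite !raddfD /= mulrDr mulrDl IHp IHq.
- by rewrite !rmorphM /= mulrA IHp -!mulrA IHq.
Qed.

Lemma weyl_y_ev e p : y e * weyl_ev p = weyl_ev (shift (- << e >>) p) * y e.
Proof.
elim/poly_alg_ind: p => [c|f|p q IHp IHq|p q IHp IHq].
- by rewrite act_scal weyl_ev_scal scal_central.
- rewrite shift_action_var mcoeffN mcoeffU; case: eqP => [<-|/eqP ef].
    rewrite opprK weyl_ev_var_add1 weyl_ev_var mulrDl -!mulrA xye.
    by rewrite mulrBr mul1r mulr1 subrK.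
  rewrite oppr0 addr0 weyl_ev_var mulrA yy -!mulrA; congr (_ * _).
  by rewrite xy // eq_sym.
- by rewrite !raddfD /= mulrDr mulrDl IHp IHq.
- by rewrite !rmorphM /= mulrA IHp -!mulrA IHq.
Qed.

Let zpow_comm e f p q : e != f -> GRing.comm (zpow x y e p) (zpow x y f q).
Proof.
have commXX (a b : B) m n : a * b = b * a -> GRing.comm (a ^+ m) (b ^+ n).
  by move=> ab; apply/commrX/commr_sym/commrX/commr_sym/ab.
move=> ef; rewrite /zpow; case: ifP => _; case: ifP => _; apply: commXX => //.
  exact: xy.
by apply/esym/xy; rewrite eq_sym.
Qed.

Let zmon_factor (d : {fset E}) (k : {malg E}) e : (msupp k `<=` d)%fset -> e \in d ->
  z k = zpow x y e k@_e * \prod_(f <- rem e d) zpow x y f k@_f.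
Proof.
have k_comm f g : GRing.comm (zpow x y f k@_f) (zpow x y g k@_g).
  by have [->|/zpow_comm] := eqVneq f g.
move=> kd ed; rewrite -(comm_prod_rem (F := fun f => zpow x y f k@_f)) //.
apply: (comm_prod_fset_incl (F := fun f => zpow x y f k@_f)) => // f.
by move/mcoeff_outdom => ->.
Qed.

(* Multiplying [z^k] by [x_e] or [y_e] only concerns the factor at [e]. *)
Let zmon_step (e : E) (b : B) (k : {malg E}) (p : int) :
  (exists c, b * zpow x y e k@_e = weyl_ev c * zpow x y e (k@_e + p)) ->
  exists c, b * z k = weyl_ev c * z (k + << p *g e >>).
Proof.
move=> [c bE]; exists c.
pose d := (e |` (msupp k `|` msupp (k + << p *g e >>)))%fset.
have ed : e \in d by rewrite !inE eqxx.
rewrite (@zmon_factor d k e) //; last first.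
  by apply/fsubsetP => f; rewrite !inE => ->; rewrite orbT.
rewrite (@zmon_factor d (k + _) e) //; last first.
  by apply/fsubsetP => f fk; rewrite in_fset1U in_fsetU fk !orbT.
rewrite mcoeffD mcoeffUU !mulrA -bE; congr (_ * _).
apply: eq_big_seq => f; rewrite mem_rem_uniq ?fset_uniq // inE => /andP[fe _].
by rewrite mcoeffD mcoeffU eq_sym (negbTE fe) addr0.
Qed.

Lemma weyl_x_zmon e k : exists c, x e * z k = weyl_ev c * z (k + << e >>).
Proof.
apply: zmon_step; case: k@_e => n.
  by exists 1; rewrite rmorph1 mul1r -PoszD addn1 /zpow /= exprS.
exists (u e - 1); rewrite weyl_ev_var_sub1.
have -> : Negz n + 1 = - n%:Z by lia.
rewrite {1}/zpow /= exprS mulrA; congr (_ * _).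
by case: n.
Qed.

Lemma weyl_y_zmon e k : exists c, y e * z k = weyl_ev c * z (k - << e >>).
Proof.
rewrite -monalgUN; apply: zmon_step; case: k@_e => [[|n]|n].
- by exists 1; rewrite rmorph1 mul1r /zpow /= expr0 mulr1 expr1.
- exists (u e); rewrite weyl_ev_var.
  have -> : n.+1%:Z + -1 = n%:Z by lia.
  by rewrite /zpow /= exprS mulrA.
- exists 1; have -> : Negz n + -1 = Negz n.+1 by lia.
  by rewrite rmorph1 mul1r /zpow /= -exprS.
Qed.

Definition weyl_normal : {malg P[{malg E}]} -> B :=
  malg_lift (fun k => z k \o* weyl_ev : {additive P -> B}).

HB.instance Definition _ := GRing.Additive.on weyl_normal.

Lemma weyl_normalU p k : weyl_normal << p *g k >> = weyl_ev p * z k.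
Proof. exact: malg_liftU. Qed.

Let weyl_normal_ind (b c : B) : (forall p k, exists f, b * (weyl_ev p * z k) = weyl_normal f) ->
  (exists f, c = weyl_normal f) -> exists f, b * c = weyl_normal f.
Proof.
move=> bU [f ->]; elim/malg_ind: f => [|f g [f' IHf] [g' IHg]|p k].
- by exists 0; rewrite !raddf0 mulr0.
- by exists (f' + g'); rewrite !raddfD /= mulrDr IHf IHg.
- by rewrite weyl_normalU.
Qed.

Lemma weyl_normal_gen_prod (s : seq (E + E)) :
  exists f, \prod_(g <- s) weyl_gen x y g = weyl_normal f.
Proof.
elim: s => [|g s IHs].
  exists << 1 *g 0 >>.
  by rewrite weyl_normalU rmorph1 mul1r /zmon msupp0 big_seq_fset0 big_nil.
rewrite big_cons; apply: weyl_normal_ind IHs => p k; case: g => e /=.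
  rewrite mulrA weyl_x_ev -mulrA; have [c ->] := weyl_x_zmon e k.
  by rewrite mulrA -rmorphM /= -weyl_normalU; eexists.
rewrite mulrA weyl_y_ev -mulrA; have [c ->] := weyl_y_zmon e k.
by rewrite mulrA -rmorphM /= -weyl_normalU; eexists.
Qed.

Lemma weyl_normal_scal c b : (exists f, b = weyl_normal f) ->
  exists f, scal c * b = weyl_normal f.
Proof.
apply: weyl_normal_ind => p k.
by rewrite mulrA -weyl_ev_scal -rmorphM /= -weyl_normalU; eexists.
Qed.
End WeylNormalForm.

Lemma weyl_normal_surj (K : comNzRingType) (E : choiceType) (q : weyl K E) :
  exists f, q = weyl_normal (weyl_xy_family K E) f.
Proof.
elim/presented_ind: q => [|q q' [f ->] [f' ->]|c s].
- by exists 0; rewrite raddf0.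
- by exists (f + f'); rewrite raddfD.
apply: weyl_normal_scal.
rewrite (eq_bigr (weyl_gen (@weyl_x K E) (@weyl_y K E))) => [|[]//].
exact: weyl_normal_gen_prod.
Qed.

Definition rising (R : pzRingType) (x : R) (n : nat) : R := \prod_(i < n) (x + i%:R).

(* If [x] acts as [T] and [y] as [u T^-1], then [y^n] acts as the rising
   factorial [u (u + 1) ... (u + n - 1)] times [T^(-n)]. *)
Definition zpow_coef (R : pzRingType) (u : R) (p : int) : R :=
  if p is Negz n then rising u n.+1 else 1.

Section ZpowCoefTheory.
Variable R : comNzRingType.
Implicit Types (x : R) (p q : int).

Lemma rising_add x m n : rising x (m + n) = rising x m * rising (x + m%:R) n.
Proof.
rewrite /rising big_split_ord; congr (_ * _).
by apply: eq_bigr => i _; rewrite natrD addrA.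
Qed.

Lemma zpow_coef_opp x p : zpow_coef x (- p) * zpow_coef (x + p%:~R) p =
  match p with
  | Posz n => \prod_(0 <= i < n) (x + i%:R)
  | Negz n => \prod_(1 <= i < n.+2) (x - i%:R)
  end.
Proof.
case: p => [[|n]|n]; first by rewrite big_geq // mulr1.
  by rewrite /= mulr1 big_mkord.
rewrite NegzE opprK mul1r rmorphN -NegzE /= big_add1 /= big_mkord.
rewrite /rising (reindex_inj rev_ord_inj); apply: eq_bigr => i _ /=.
have -> : n.+1%:~R = n%:R + 1 :> R by rewrite -pmulrn -natr1.
rewrite subSS natrB ?leq_ord // -natr1; ring.
Qed.

Lemma zpow_coefC x p q : 0 <= p * q ->
  zpow_coef x p * zpow_coef (x - p%:~R) q = zpow_coef x q * zpow_coef (x - q%:~R) p.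
Proof.
have NegzK n : x - (Negz n)%:~R = x + n.+1%:R by rewrite NegzE rmorphN opprK.
case: p => [m|m]; case: q => [n|n] //= pq.
- have -> : m = 0%N by lia.
  by rewrite subr0 mul1r mulr1.
- have -> : n = 0%N by lia.
  by rewrite subr0 mul1r mulr1.
- by rewrite !NegzK -!rising_add addnC.
Qed.
End ZpowCoefTheory.

Section SkewWeylFamily.
Variables (K : comNzRingType) (E : choiceType) (R : pzAlgType K).
Variables (a : alg_action {malg E} R) (u : E -> R).
Hypotheses (u_comm : forall e f, u e * u f = u f * u e)
  (a_u : forall k e, a k (u e) = u e - (k@_e)%:~R).
Local Notation S := (skew_ring a).

Definition skew_x (e : E) : S := skewU a 1 << e >>.
Definition skew_y (e : E) : S := skewU a (u e) (- << e >>).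

Let a_uU e f (z : int) : e != f -> a << z *g e >> (u f) = u f.
Proof. by move=> ef; rewrite a_u mcoeffU (negbTE ef) subr0. Qed.

Lemma skew_weyl_family : weyl_family skew_x skew_y.
Proof.
split=> e f.
- by rewrite [LHS]skew_mulUU [RHS]skew_mulUU !rmorph1 addrC.
- have [->//|ef] := eqVneq e f; have fe : f != e by rewrite eq_sym.
  rewrite [LHS]skew_mulUU [RHS]skew_mulUU -!monalgUN (a_uU _ ef) (a_uU _ fe) u_comm.
  by rewrite [X in skewU _ _ X]addrC.
rewrite [LHS]skew_mulUU [skew_x f * _]skew_mulUU rmorph1 mulr1 mul1r [<< f >> + _]addrC.
rewrite a_u mcoeffU [f == e]eq_sym; case: eqP => [->|_]; last by rewrite subr0 addr0.
by rewrite addNr -(skewU10 a) -skewUD subrK.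
Qed.

Lemma zpow_skew e p : zpow skew_x skew_y e p = skewU a (zpow_coef (u e) p) << p *g e >>.
Proof.
rewrite /zpow; case: p => n /=.
  elim: n => [|n IHn]; first by rewrite expr0 monalgU0 skewU10.
  by rewrite exprS IHn skew_mulUU rmorph1 mulr1 -monalgUD -PoszD add1n.
have -> : Negz n = - n.+1%:Z by lia.
elim: n.+1 => [|{}n IHn]; first by rewrite /rising big_ord0 expr0 monalgU0 skewU10.
rewrite exprSr IHn skew_mulUU /rising big_ord_recr /= a_u mcoeffUU -monalgUN -monalgUD.
by rewrite rmorphN opprK -opprD -PoszD addn1.
Qed.

Lemma act_zpow_coef k e p : a k (zpow_coef (u e) p) = zpow_coef (u e - (k@_e)%:~R) p.
Proof.
case: p => n; first exact: rmorph1.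
rewrite /= rmorph_prod; apply: eq_bigr => i _.
by rewrite rmorphD rmorph_nat /= a_u.
Qed.

Definition z_coef (k : {malg E}) : R := \prod_(e <- msupp k) zpow_coef (u e) k@_e.

Let prod_zpow_skew (k : {malg E}) (s : seq E) : uniq s ->
  \prod_(e <- s) zpow skew_x skew_y e k@_e =
  skewU a (\prod_(e <- s) zpow_coef (u e) k@_e) (\sum_(e <- s) << k@_e *g e >>).
Proof.
elim: s => [|e s IHs] /=; first by rewrite !big_nil skewU10.
move=> /andP[es /IHs {}IHs]; rewrite !big_cons IHs zpow_skew skew_mulUU.
congr (skewU a (_ * _) _); rewrite rmorph_prod; apply: eq_big_seq => f fs.
rewrite /= act_zpow_coef mcoeffU; case: eqP => [ef|_]; last by rewrite subr0.
by rewrite ef fs in es.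
Qed.

Lemma zmon_skew k : zmon skew_x skew_y k = skewU a (z_coef k) k.
Proof. by rewrite /zmon prod_zpow_skew ?fset_uniq // -monalgE. Qed.

Definition weyl_skew : weyl K E -> S := presented_eval (weyl_gen skew_x skew_y).

Let weyl_skew_rel f g : weyl_rel f g ->
  free_eval (weyl_gen skew_x skew_y) f = free_eval (weyl_gen skew_x skew_y) g.
Proof. exact: weyl_gen_rel skew_weyl_family. Qed.

Lemma weyl_skew_morphism : alg_morphism weyl_skew.
Proof. exact: presented_eval_morphism weyl_skew_rel. Qed.

Lemma weyl_skew_x e : weyl_skew (weyl_x K e) = skew_x e.
Proof. exact: (presented_eval_gen weyl_skew_rel (inl e)). Qed.

Lemma weyl_skew_y e : weyl_skew (weyl_y K e) = skew_y e.
Proof. exact: (presented_eval_gen weyl_skew_rel (inr e)). Qed.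

Lemma weyl_skew_z k : weyl_skew (weyl_z K k) = skewU a (z_coef k) k.
Proof.
rewrite -zmon_skew -(funext weyl_skew_x : _ \o _ = _) -(funext weyl_skew_y : _ \o _ = _).
exact: alg_morph_zmon _ _ _ weyl_skew_morphism.
Qed.

Lemma weyl_skew_ev p :
  weyl_skew (weyl_ev (@weyl_x K E) (@weyl_y K E) p) = skewU a (poly_eval u p) 0.
Proof.
rewrite (alg_morph_poly_eval _ _ (skewU0_morphism a)).
rewrite (alg_morph_poly_eval _ _ weyl_skew_morphism); congr (poly_eval _ p).
apply/funext => e /=; rewrite (alg_morphM weyl_skew_morphism) weyl_skew_x weyl_skew_y.
by rewrite [LHS]skew_mulUU rmorph1 mulr1 addNr.
Qed.

Hypotheses (z_coef_rreg : forall k, GRing.rreg (z_coef k))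
  (poly_eval_u_inj : injective (poly_eval u : poly_alg K E -> R)).

Lemma weyl_skew_inj : injective weyl_skew.
Proof.
apply: (alg_morph_inj weyl_skew_morphism) => q; have [f ->] := weyl_normal_surj q => f0.
have ev_morph := comm_poly_eval_morphism u_comm.
suff -> : f = 0 by rewrite raddf0.
apply/malgP => k; rewrite mcoeff0; apply: poly_eval_u_inj; apply: (z_coef_rreg (k := k)).
rewrite (alg_morph0 ev_morph) mul0r.
have termE l : weyl_skew (weyl_ev (@weyl_x K E) (@weyl_y K E) f@_l * weyl_z K l) =
    skewU a (poly_eval u f@_l * z_coef l) l.
  rewrite (alg_morphM weyl_skew_morphism) weyl_skew_ev weyl_skew_z.
  by rewrite skew_mulUU act0 add0r.
have := congr1 (mcoeff k) f0; rewrite (alg_morph_sum weyl_skew_morphism).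
rewrite (eq_bigr _ (fun l _ => termE l)) mcoeff_sum_skewU mcoeff0.
by case: msuppP => [_ <-|_ _]; rewrite ?mulr1n // (alg_morph0 ev_morph) mul0r.
Qed.
End SkewWeylFamily.

(** * The algebra of a multiquiver *)

Section MaximalCommutative.
Variables (K : comPzRingType) (A : pzAlgType K) (S : set A).

Lemma max_comm_subalgebraP : max_comm_subalgebra S <->
  comm_subalgebra S /\ forall a, (forall s, S s -> a * s = s * a) -> S a.
Proof.
split=> [[S_comm S_max]|[S_comm S_cent]]; split=> //; last first.
  move=> T [_ T_comm] ST; apply/seteqP; split=> // a Ta.
  by apply: S_cent => s /ST Ts; exact: T_comm.
move=> a aS; have [_ S_mulC] := S_comm.
(* The bicommutant of a commuting set is a commutative subalgebra. *)
pose Sa : set A := [set b | S b \/ b = a]%classic.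
pose commutant : set A := [set b | forall c, Sa c -> b * c = c * b]%classic.
pose T : set A := [set b | forall c, commutant c -> b * c = c * b]%classic.
have SaT b : Sa b -> T b by move=> Sb c /(_ b Sb).
have Sa_comm b : Sa b -> commutant b.
  by move=> [Sb|->] c [Sc|->] //; [exact: S_mulC|exact/esym/aS|exact: aS].
suff <- : T = S by apply: SaT; right.
apply: S_max => [|b Sb]; last by apply: SaT; left.
split; first split.
- by move=> c b _; rewrite scal_central.
- by move=> b c Tb Tc d cd; rewrite mulrDl mulrDr Tb // Tc.
- by move=> b c Tb Tc d cd; rewrite -mulrA Tc // mulrA Tb // mulrA.
by move=> b c Tb Tc; apply: Tb => d Sd; apply: Tc; exact: Sa_comm.
Qed.
End MaximalCommutative.

Section GammaTheory.
Variables (V E : choiceType) (Gam : multiquiver V E).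

Lemma mem_edges_at v e : (e \in edges_at Gam v) = incident Gam v e.
Proof.
rewrite /edges_at in_fset_set; last exact: locally_finite.
by apply/idP/idP; rewrite in_setE.
Qed.

Definition end_coef (x : option (V * nat)) (v : V) : int :=
  if has_vertex x v then (multiplicity x)%:Z else 0.

Lemma gamma_coefE e v :
  gamma_coef Gam e v = end_coef (tgt Gam e) v - end_coef (src Gam e) v.
Proof.
rewrite /gamma_coef /end_coef /has_vertex.
case t_e : (tgt Gam e) => [[w n]|]; case s_e : (src Gam e) => [[u m]|] /=;
  rewrite ?subr0 ?sub0r //; last by case: ifP; rewrite ?oppr0.
have uw := no_loops s_e t_e; rewrite !(inj_eq Some_inj).
have [wv|_] := eqVneq w v; have [uv|_] := eqVneq u v; rewrite ?subr0 ?sub0r //.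
by rewrite uv wv eqxx in uw.
Qed.

Lemma gamma_coef_eq0 v e : ~~ incident Gam v e -> gamma_coef Gam e v = 0.
Proof. by rewrite gamma_coefE /end_coef negb_or => /andP[/negbTE -> /negbTE ->]. Qed.

Lemma gamma_coef_sign e v w : v != w -> gamma_coef Gam e v * gamma_coef Gam e w <= 0.
Proof.
move=> vw; rewrite !gamma_coefE.
have end_ge0 x y : 0 <= end_coef x y by rewrite /end_coef; case: ifP.
have end0 x : end_coef x v * end_coef x w = 0.
  rewrite /end_coef /has_vertex; case: x => [[u n]|] /=; last exact: mul0r.
  by case: eqP => [[->]|_]; rewrite ?mul0r // (inj_eq Some_inj) (negbTE vw) mulr0.
rewrite mulrBl !mulrBr !end0 sub0r subr0 -opprD oppr_le0.
by rewrite addr_ge0 ?mulr_ge0.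
Qed.

Definition gammaU (v : V) (c : int) : {malg E} :=
  \sum_(e <- edges_at Gam v) << c * gamma_coef Gam e v *g e >>.

Fact gammaU_is_zmod_morphism v : {morph gammaU v : x y / x - y}.
Proof.
move=> x y; rewrite /gammaU -sumrB; apply: eq_bigr => e _.
by rewrite mulrBl monalgUB.
Qed.

HB.instance Definition _ v :=
  GRing.isZmodMorphism.Build int {malg E} (gammaU v) (gammaU_is_zmod_morphism v).

Let gammaE : gamma Gam = malg_lift gammaU. Proof. by []. Qed.

Fact gamma_is_zmod_morphism : {morph gamma Gam : x y / x - y}.
Proof. by rewrite gammaE; exact: raddfB. Qed.

HB.instance Definition _ :=
  GRing.isZmodMorphism.Build {malg V} {malg E} (gamma Gam) gamma_is_zmod_morphism.

Lemma mcoeff_gammaU c v e : (gamma Gam << c *g v >>)@_e = c * gamma_coef Gam e v.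
Proof.
rewrite gammaE malg_liftU /= /gammaU (mcoeff_sumU (f := id)) // mem_edges_at.
by have [//|/gamma_coef_eq0 ->] := boolP (incident Gam v e); rewrite mulr0.
Qed.

Lemma msupp_gammaU v : (msupp (gamma Gam << v >>) `<=` edges_at Gam v)%fset.
Proof.
apply/fsubsetP => e; rewrite -mcoeff_neq0 mcoeff_gammaU mem_edges_at.
by apply: contraNT => /gamma_coef_eq0 ->; rewrite mulr0.
Qed.

Lemma gamma_injP : injective (gamma Gam) <-> forall a, gamma Gam a = 0 -> a = 0.
Proof.
split=> [gamma_inj a a0|]; last exact: raddf_inj.
by apply: gamma_inj; rewrite a0 raddf0.
Qed.
End GammaTheory.

Section ShiftCoefficients.
Variables (K : comNzRingType) (E : choiceType).
Local Notation u := (@poly_var K E).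
Local Notation shift := (shift_action K E).

Lemma lreg_z_coef k : GRing.lreg (z_coef u k).
Proof.
apply: big_ind => [|p q|e _]; [exact: lreg1|exact: lregM|].
case: k@_e => n /=; first exact: lreg1.
apply: big_ind => [|p q|i _]; [exact: lreg1|exact: lregM|].
exact: (@lreg_poly_varD K E e i).
Qed.

Lemma z_coefM_shift (d : {fset E}) k l : (msupp k `<=` d)%fset -> (msupp l `<=` d)%fset ->
  z_coef u k * shift k (z_coef u l) =
  \prod_(e <- d) (zpow_coef (u e) k@_e * zpow_coef (u e - (k@_e)%:~R) l@_e).
Proof.
have z_coefEw m : (msupp m `<=` d)%fset -> z_coef u m = \prod_(e <- d) zpow_coef (u e) m@_e.
  by move=> md; rewrite /z_coef (big_fset_incl _ md) // => e _ /mcoeff_outdom ->.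
move=> kd ld; rewrite (z_coefEw k kd) (z_coefEw l ld) rmorph_prod big_split /=.
congr (_ * _); apply: eq_bigr => e _.
exact: (act_zpow_coef (@shift_action_var K E)).
Qed.
End ShiftCoefficients.

Section MultiquiverAlgebra.
Variables (K : fieldType) (charK : [pchar K] =i pred0).
Variables (V E : choiceType) (Gam : multiquiver V E).
Local Notation P := (poly_alg K E).
Local Notation u := (@poly_var K E).
Local Notation shift := (shift_action K E).
Local Notation gamma := (gamma Gam).
Local Notation D := (mq_datum charK Gam).
Local Notation mq_action := (act_pullback shift gamma).
Local Notation cX v := (z_coef u (gamma << v >>)).
Local Notation cY v := (z_coef u (- gamma << v >>)).

Lemma mq_actionU v p : mq_action << v >> p = mq_sigma Gam v p.
Proof.
rewrite /= shift_actionE; congr (poly_eval _ p); apply/funext => e.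
by rewrite /shift_var mcoeff_gammaU mul1r.
Qed.

Lemma mq_cYX v : cY v * mq_action (- << v >>) (cX v) = mq_t K Gam v.
Proof.
have v_supp := msupp_gammaU Gam v; have Nv_supp := v_supp; rewrite -msuppN in Nv_supp.
rewrite /= raddfN (z_coefM_shift K Nv_supp v_supp).
apply: eq_bigr => e _; rewrite mcoeffN mcoeff_gammaU mul1r rmorphN opprK.
exact: zpow_coef_opp.
Qed.

Lemma mq_cXYC v w : v != w ->
  cX v * mq_action << v >> (cY w) = scal 1 * (cY w * mq_action (- << w >>) (cX v)).
Proof.
move=> vw; rewrite scal1 mul1r /= raddfN.
pose d := (edges_at Gam v `|` edges_at Gam w)%fset.
have vd : (msupp (gamma << v >>) `<=` d)%fset.
  exact: fsubset_trans (msupp_gammaU Gam v) (fsubsetUl _ _).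
have wd : (msupp (- gamma << w >>) `<=` d)%fset.
  by rewrite msuppN; exact: fsubset_trans (msupp_gammaU Gam w) (fsubsetUr _ _).
rewrite (z_coefM_shift K vd wd) (z_coefM_shift K wd vd); apply: eq_bigr => e _.
apply: zpow_coefC; rewrite mcoeffN !mcoeff_gammaU !mul1r mulrN oppr_ge0.
exact: gamma_coef_sign.
Qed.

Definition mq_realization : skew_realization D (fun _ _ => 1) :=
  @SkewRealization K P V D _ mq_action (fun v => cX v) (fun v => cY v) mq_actionU
    (fun v => mulrC (cX v)) (fun v => mulrC (cY v)) (fun v => @lreg_z_coef K E _)
    (fun v => @lreg_z_coef K E _) mq_cYX mq_cXYC.

Definition mq_skew : mq_tgw charK Gam -> skew_ring mq_action := @tgw_skew _ _ _ _ _ mq_realization.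

Lemma mq_skew_morphism : alg_morphism mq_skew.
Proof. exact: tgw_skew_morphism. Qed.

Lemma mq_skew_inj : injective mq_skew.
Proof. by apply: tgw_skew_inj => *; exact: unitr1. Qed.

Lemma mq_skew_r p : mq_skew (tgw_r D (fun _ _ => 1) p) = skewU mq_action p 0.
Proof. exact: tgw_skew_r. Qed.

Lemma mq_skew_monomial (a : {malg V}) :
  exists x p, p != 0 /\ mq_skew x = skewU mq_action p a.
Proof.
have [x [p [p_reg xE]]] := tgw_skew_monomial mq_realization a.
by exists x, p; split; first exact: lreg_neq0.
Qed.

Lemma mq_RP (x : mq_tgw charK Gam) :
  mq_R charK Gam x <-> forall a, a != 0 -> (mq_skew x)@_a = 0.
Proof.
split=> [[p _ <-] a a0|x0]; first by rewrite mq_skew_r mcoeff_skewU eq_sym (negbTE a0).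
exists (mq_skew x)@_0 => //; apply: mq_skew_inj; rewrite mq_skew_r.
by apply/malgP => a; rewrite mcoeff_skewU eq_sym; have [->|/x0 ->] := eqVneq a 0.
Qed.

Lemma mq_R_comm_subalgebra : comm_subalgebra (mq_R charK Gam).
Proof.
have mq_skew_R x : mq_R charK Gam x <-> exists p, mq_skew x = skewU mq_action p 0.
  split=> [[p _ <-]|[p xE]]; first by exists p; exact: mq_skew_r.
  by exists p => //; apply: mq_skew_inj; rewrite mq_skew_r xE.
have p_morph := skewU0_morphism mq_action.
split; first split=> [c|x y|x y].
- by apply/mq_skew_R; exists (scal c); rewrite (alg_morph_scal mq_skew_morphism).
- move=> /mq_skew_R[p xE] /mq_skew_R[q yE]; apply/mq_skew_R; exists (p + q).
  by rewrite (alg_morphD mq_skew_morphism) xE yE skewUD.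
- move=> /mq_skew_R[p xE] /mq_skew_R[q yE]; apply/mq_skew_R; exists (p * q).
  by rewrite (alg_morphM mq_skew_morphism) xE yE [RHS](alg_morphM p_morph).
move=> x y /mq_skew_R[p xE] /mq_skew_R[q yE]; apply: mq_skew_inj.
rewrite [LHS](alg_morphM mq_skew_morphism) [RHS](alg_morphM mq_skew_morphism) xE yE.
by rewrite !skew_mulUU !act0 (mulrC p).
Qed.

Lemma intr_pchar0_neq0 (z : int) : z != 0 -> z%:~R != 0 :> K.
Proof.
case: z => [[//|n]|n] _; first by rewrite -pmulrn ((pcharf0P K).1 charK).
by rewrite NegzE rmorphN /= oppr_eq0 -pmulrn ((pcharf0P K).1 charK).
Qed.

Lemma mulrz_poly_eq0 (p : P) (z : int) : z != 0 -> p *~ z = 0 -> p = 0.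
Proof.
move=> /intr_pchar0_neq0 z0 pz0; apply/malgP => m; rewrite mcoeff0.
apply/eqP; have /eqP := congr1 (mcoeff m) pz0.
by rewrite raddfMz mcoeff0 -mulrzr mulf_eq0 (negbTE z0) orbF.
Qed.

(* [r T^a] commutes with [u_e] iff [r gamma(a)_e = 0]. *)
Lemma mq_centralizerP (x : mq_tgw charK Gam) :
  (forall y, mq_R charK Gam y -> x * y = y * x) <->
  forall a, gamma a != 0 -> (mq_skew x)@_a = 0.
Proof.
have commP p : x * tgw_r D (fun _ _ => 1) p = tgw_r D (fun _ _ => 1) p * x <->
    forall a, (mq_skew x)@_a * mq_action a p = p * (mq_skew x)@_a.
  rewrite -skewU0_commP -mq_skew_r -!(alg_morphM mq_skew_morphism).
  by split=> [->|/mq_skew_inj].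
split=> [x_comm a|x0 _ [p _ <-]]; last first.
  apply/commP => a; have [a0|/x0 ->] := eqVneq (gamma a) 0; last by rewrite mulr0 mul0r.
  by rewrite /= a0 act0 mulrC.
apply: contra_neq_eq => xa_neq0; apply/malgP => e; rewrite mcoeff0; apply/eqP.
apply: contra_neqT xa_neq0 => /mulrz_poly_eq0; apply.
have /commP/(_ a) : x * tgw_r D (fun _ _ => 1) (u e) = tgw_r D (fun _ _ => 1) (u e) * x.
  by apply: x_comm; exists (u e).
rewrite /= shift_action_var mulrBr mulrC mulrzr => /eqP.
by rewrite subr_eq addrC -subr_eq subrr => /eqP/esym.
Qed.

Lemma gamma_inj_mq_R_max : injective gamma -> max_comm_subalgebra (mq_R charK Gam).
Proof.
move=> /gamma_injP gamma_ker0; apply/max_comm_subalgebraP.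
split; first exact: mq_R_comm_subalgebra.
move=> x /mq_centralizerP x0; apply/mq_RP => a a_neq0.
by apply: x0; apply: contra_neq a_neq0; exact: gamma_ker0.
Qed.

Lemma mq_R_max_gamma_inj : max_comm_subalgebra (mq_R charK Gam) -> injective gamma.
Proof.
move=> /max_comm_subalgebraP[_ R_cent]; apply/gamma_injP => a a0.
have [x [p [p0 xE]]] := mq_skew_monomial a.
have /R_cent/mq_RP/(_ a) : forall y, mq_R charK Gam y -> x * y = y * x.
  apply/mq_centralizerP => b b0; rewrite xE mcoeff_skewU.
  by have [ab|//] := eqVneq a b; rewrite -ab a0 eqxx in b0.
rewrite xE mcoeff_skewU eqxx mulr1n => pa; apply/eqP; apply: contraTT p0 => /pa ->.
by rewrite eqxx.
Qed.

Local Notation weyl_emb := (weyl_skew shift u).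

Let u_comm e f : u e * u f = u f * u e. Proof. exact: mulrC. Qed.

Lemma weyl_emb_inj : injective weyl_emb.
Proof.
apply: (weyl_skew_inj u_comm (@shift_action_var K E)) => [k p q|p q].
  by rewrite ![_ * z_coef u k]mulrC; exact: lreg_z_coef.
by rewrite !poly_eval_id.
Qed.

Lemma weyl_emb_canonical_rep x :
  weyl_emb (canonical_rep charK Gam x) = skew_push (mq_skew x).
Proof.
rewrite /mq_skew tgw_skewE (alg_morphism_free_eval _ _ (skew_push_morphism shift gamma)).
rewrite [LHS](alg_morphism_free_eval _ _ (weyl_skew_morphism u_comm (@shift_action_var K E))).
congr (free_eval _ _); apply/funext => -[[p|v]|v] /=.
- by rewrite (weyl_skew_ev u_comm (@shift_action_var K E)) skew_pushU raddf0 poly_eval_id.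
- by rewrite (weyl_skew_z u_comm (@shift_action_var K E)) skew_pushU.
- by rewrite (weyl_skew_z u_comm (@shift_action_var K E)) skew_pushU raddfN.
Qed.

Lemma gamma_inj_canonical_rep_inj : injective gamma -> injective (canonical_rep charK Gam).
Proof.
move=> gamma_inj x y xy; apply: mq_skew_inj; apply: (skew_push_inj gamma_inj).
by rewrite -!weyl_emb_canonical_rep xy.
Qed.

Lemma canonical_rep_inj_gamma_inj : injective (canonical_rep charK Gam) -> injective gamma.
Proof.
move=> rep_inj; apply/gamma_injP => a a0; have [x [p [p0 xE]]] := mq_skew_monomial a.
have /(congr1 mq_skew) : x = tgw_r D (fun _ _ => 1) p.
  apply: rep_inj; apply: weyl_emb_inj.
  rewrite [LHS]weyl_emb_canonical_rep [RHS]weyl_emb_canonical_rep xE mq_skew_r.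
  by rewrite !skew_pushU /= a0 raddf0.
rewrite xE mq_skew_r => /(congr1 (mcoeff a)); rewrite !mcoeff_skewU eqxx eq_sym.
by case: eqP => // _ /eqP; rewrite mulr1n (negbTE p0).
Qed.
End MultiquiverAlgebra.

(** * Potentials and balanced cycles *)

Section Joins.
Variables (V E : choiceType) (Gam : multiquiver V E).

(* The edge [e], in either direction, has the ends [x.1] and [y.1], at which its
   multiplicities are [x.2] and [y.2]. *)
Definition joins (e : E) (x y : V * nat) : bool :=
  (src Gam e == Some x) && (tgt Gam e == Some y) ||
  (src Gam e == Some y) && (tgt Gam e == Some x).

Lemma joins_sym e x y : joins e x y = joins e y x.
Proof. exact: orbC. Qed.

Lemma joins_gt0 e x y : joins e x y -> (0 < x.2)%N.
Proof.
by case: x => v n /orP[] /andP[/eqP src_e /eqP tgt_e]; [exact: src_gt0 src_e|exact: tgt_gt0 tgt_e].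
Qed.

Lemma joins_inj e x y x' y' : joins e x y -> joins e x' y' ->
  (x' = x /\ y' = y) \/ (x' = y /\ y' = x).
Proof.
by move=> /orP[] /andP[/eqP src_e /eqP tgt_e] /orP[] /andP[];
  rewrite src_e tgt_e => /eqP[->] /eqP[->]; auto.
Qed.

Lemma joins_incident e x y : joins e x y -> incident Gam x.1 e.
Proof.
by rewrite /incident /has_vertex => /orP[] /andP[/eqP -> /eqP ->]; rewrite eqxx ?orbT.
Qed.

Definition potential_at (F : pzSemiRingType) (a : V -> F) (e : E) : Prop :=
  forall x y, joins e x y -> a x.1 * x.2%:R = a y.1 * y.2%:R.

Definition potential (F : pzSemiRingType) (a : V -> F) : Prop :=
  forall e, potential_at a e.

Lemma joins_potential_at (F : pzSemiRingType) (a : V -> F) e x y : joins e x y ->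
  a x.1 * x.2%:R = a y.1 * y.2%:R -> potential_at a e.
Proof. by move=> e_xy a_xy x' y' /(joins_inj e_xy)[] [-> ->]. Qed.

Definition nnd_labelling n (v : 'I_n -> V) (e : 'I_n -> E) (out inn : 'I_n -> nat) :=
  [/\ (0 < n)%N, bijective v, bijective e
    & forall i, joins (e i) (v i, out i) (v (ordS i), inn i)].

Lemma prod_ordS (R : comPzSemiRingType) n (f : 'I_n -> R) : \prod_i f (ordS i) = \prod_i f i.
Proof. by rewrite [RHS](reindex (@ordS n)) //; apply: onW_bij; exact: ordS_bij. Qed.

Lemma cyclic_potential_prod (F : numDomainType) (a : V -> F) n v e (out inn : 'I_n -> nat) :
  (forall w, a w != 0) -> potential a ->
  (forall i, joins (e i) (v i, out i) (v (ordS i), inn i)) ->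
  (\prod_i out i = \prod_i inn i)%N.
Proof.
move=> a_neq0 a_pot e_joins.
have : \prod_i (a (v i) * (out i)%:R) = \prod_i (a (v (ordS i)) * (inn i)%:R).
  by apply: eq_bigr => i _; exact: a_pot (e_joins i).
rewrite !big_split /= (prod_ordS (fun i => a (v i))) => /mulfI prodE.
apply/eqP; rewrite -(eqr_nat F) !natr_prod; apply/eqP/prodE.
by apply/prodf_neq0 => i _.
Qed.

(* Around the cycle, the potential at the [k]-th vertex is the product of the
   ratios of the multiplicities of the previous edges. *)
Lemma nnd_labelling_potential n (v : 'I_n -> V) e out inn :
  nnd_labelling v e out inn -> (\prod_i out i = \prod_i inn i)%N ->
  exists2 a : V -> rat, forall w, a w != 0 & potential a.
Proof.
move=> [n_gt0 [v' vK v'K] [e' eK e'K] e_joins] balanced.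
have out0 i : (out i)%:R != 0 :> rat by rewrite pnatr_eq0 -lt0n; exact: joins_gt0 (e_joins i).
have inn0 i : (inn i)%:R != 0 :> rat.
  by rewrite pnatr_eq0 -lt0n; have := e_joins i; rewrite joins_sym => /joins_gt0.
pose c (k : nat) : rat := \prod_(j < n | (j < k)%N) ((out j)%:R / (inn j)%:R).
exists (fun w => c (v' w)) => [w|e0].
  by apply/prodf_neq0 => j _; rewrite mulf_neq0 ?invr_neq0.
have cS (i : 'I_n) : c i * (out i)%:R = c i.+1 * (inn i)%:R.
  rewrite /c [in RHS](bigD1 i) //= mulrC mulrAC divfK //; congr (_ * _).
  by apply: eq_bigl => j; rewrite ltnS ltn_neqAle andbC.
have cn : c n = c 0%N.
  rewrite /c [RHS]big_pred0 // (eq_bigl xpredT) => [|j]; last exact: ltn_ord.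
  rewrite prodf_div -!natr_prod balanced divff // natr_prod.
  by apply/prodf_neq0 => i _.
rewrite -(e'K e0); apply: (joins_potential_at (e_joins (e' e0))) => /=.
rewrite !vK cS /=; congr (_ * _); set i := e' e0.
have [i_lt|] := ltnP i.+1 n; first by rewrite modn_small.
by rewrite leq_eqVlt ltnS leqNgt ltn_ord orbF => /eqP <-; rewrite modnn cn.
Qed.
End Joins.

Section SignEquivalence.
Variables (V E : choiceType) (Gam : multiquiver V E).

Lemma joins_reverse r e x y : joins (reverse_edges Gam r) e x y = joins Gam e x y.
Proof. by rewrite /joins /=; case: (r e); rewrite // orbC andbC [X in _ || X]andbC. Qed.

Lemma sign_equivalent_labelling (V' E' : choiceType) (Gam' : multiquiver V' E')
    n (v' : 'I_n -> V') e' out inn :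
  sign_equivalent Gam Gam' -> cycle_labelling Gam' v' e' out inn ->
  exists v e, @nnd_labelling V E Gam n v e out inn.
Proof.
move=> [r [f [g [[f' fK f'K] [g' gK g'K] f_src f_tgt]]]] [n_gt0 v'_bij e'_bij src_e' tgt_e'].
exists (f' \o v'), (g' \o e'); split=> // [||i].
- by apply: bij_comp v'_bij; exists f.
- by apply: bij_comp e'_bij; exists g.
have end_inv x w k : omap (fun vn => (f vn.1, vn.2)) x = Some (w, k) -> x = Some (f' w, k).
  by case: x => [[y l]|] //= [<- <-]; rewrite fK.
rewrite -(joins_reverse r) /joins; apply/orP; left.
by apply/andP; split; apply/eqP/end_inv; rewrite -?f_src -?f_tgt /= g'K ?src_e' ?tgt_e'.
Qed.

Lemma nnd_labelling_directed n (v : 'I_n -> V) e out inn : nnd_labelling Gam v e out inn ->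
  exists2 Gam' : multiquiver V E, sign_equivalent Gam Gam' & cycle_labelling Gam' v e out inn.
Proof.
move=> [n_gt0 v_bij e_bij e_joins]; have [e' eK e'K] := e_bij.
pose r e0 := src Gam e0 != Some (v (e' e0), out (e' e0)).
exists (reverse_edges Gam r).
  exists r, id, id; split; [by exists id|by exists id| |] => e0.
    by case: (src _ e0) => [[]|].
  by case: (tgt _ e0) => [[]|].
have ends i : src (reverse_edges Gam r) (e i) = Some (v i, out i) /\
    tgt (reverse_edges Gam r) (e i) = Some (v (ordS i), inn i).
  rewrite /= /r eK; case: eqVneq => [s_e|s_e] /=.
    have := e_joins i; rewrite /joins s_e eqxx /= => /orP[/eqP|/andP[/eqP[-> ->] /eqP]] -> //.
  have := e_joins i; rewrite /joins (negbTE s_e) /=.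
  by move=> /andP[/eqP -> /eqP ->].
by split=> // i; have [] := ends i.
Qed.

Lemma nnd_cycleP : nnd_cycle Gam <-> exists n v e out inn, @nnd_labelling V E Gam n v e out inn.
Proof.
split=> [[V' [E' [Gam' [[n [v' [e' [out [inn lab]]]]] sgn]]]]|[n [v [e [out [inn lab]]]]]].
  have [v [e]] := sign_equivalent_labelling sgn lab.
  by exists n, v, e, out, inn.
have [Gam' sgn dir] := nnd_labelling_directed lab.
by exists V, E, Gam'; split=> //; exists n, v, e, out, inn.
Qed.

Lemma balanced_nnd_cycleP : balanced_nnd_cycle Gam <-> exists n v e out inn,
  @nnd_labelling V E Gam n v e out inn /\ (\prod_i out i = \prod_i inn i)%N.
Proof.
split=> [[V' [E' [Gam' [[n [v' [e' [out [inn [lab bal]]]]]] sgn]]]]|].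
  have [v [e]] := sign_equivalent_labelling sgn lab.
  by exists n, v, e, out, inn.
move=> [n [v [e [out [inn [lab bal]]]]]]; have [Gam' sgn dir] := nnd_labelling_directed lab.
by exists V, E, Gam'; split=> //; exists n, v, e, out, inn.
Qed.

Lemma potential_balanced (F : numDomainType) (a : V -> F) :
  (forall w, a w != 0) -> potential Gam a -> nnd_cycle Gam -> balanced_nnd_cycle Gam.
Proof.
move=> a_neq0 a_pot /nnd_cycleP[n [v [e [out [inn lab]]]]]; apply/balanced_nnd_cycleP.
exists n, v, e, out, inn; split=> //; have [_ _ _ e_joins] := lab.
exact: cyclic_potential_prod a_neq0 a_pot e_joins.
Qed.

Lemma balanced_potential : balanced_nnd_cycle Gam ->
  exists2 a : V -> rat, forall w, a w != 0 & potential Gam a.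
Proof.
move=> /balanced_nnd_cycleP[n [v [e [out [inn [lab bal]]]]]].
exact: nnd_labelling_potential lab bal.
Qed.
End SignEquivalence.

Section Subgraphs.
Variables (V E : choiceType) (Gam : multiquiver V E).

Lemma restrict_end_eqSome (V' : set V) x (y : V' * nat) :
  (restrict_end V' x == Some y) = (x == Some (val y.1, y.2)).
Proof.
case: y => w n; apply/eqP/eqP => [/restrict_endP //|->] /=.
by rewrite valK.
Qed.

Lemma joins_subgraph (V' : set V) (E' : set E) (e : E') (x y : V' * nat) :
  joins (subgraph Gam V' E') e x y = joins Gam (val e) (val x.1, x.2) (val y.1, y.2).
Proof. by rewrite /joins /= !restrict_end_eqSome. Qed.

Lemma potential_subgraph (F : pzSemiRingType) (a : V -> F) (V' : set V) (E' : set E) :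
  potential Gam a -> potential (subgraph Gam V' E') (fun v : V' => a (val v)).
Proof. by move=> a_pot e x y; rewrite joins_subgraph => /a_pot. Qed.

Definition corange (T : Type) (U : choiceType) (f : T -> U) (t : T) : range f :=
  exist (fun u => u \in range f) (f t) (mem_range f t).

Lemma corange_bij (T : Type) (U : choiceType) (f : T -> U) :
  injective f -> bijective (corange f).
Proof.
move=> f_inj; rewrite -setTT_bijective; split=> //.
  by move=> s t _ _ /(congr1 val)/f_inj.
move=> [u fu] _; have := fu; rewrite inE => -[t _ ftu].
by exists t => //; apply: val_inj.
Qed.

Definition cycles_balanced := forall (V' : set V) (E' : set E),
  nnd_cycle (subgraph Gam V' E') -> balanced_nnd_cycle (subgraph Gam V' E').

Lemma simple_cycle_balanced n (v : 'I_n -> V) (e : 'I_n -> E) out inn :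
  cycles_balanced -> (0 < n)%N -> injective v -> injective e ->
  (forall i, joins Gam (e i) (v i, out i) (v (ordS i), inn i)) ->
  (\prod_i out i = \prod_i inn i)%N.
Proof.
move=> bal n_gt0 v_inj e_inj e_joins; pose C := subgraph Gam (range v) (range e).
have C_joins i : joins C (corange e i) (corange v i, out i) (corange v (ordS i), inn i).
  by rewrite joins_subgraph; exact: e_joins.
have [|a a_neq0 a_pot] := @balanced_potential _ _ C.
  apply/bal/nnd_cycleP; exists n, (corange v), (corange e), out, inn.
  by split=> //; exact: corange_bij.
exact: cyclic_potential_prod a_neq0 a_pot C_joins.
Qed.
End Subgraphs.

Section BalancedPotential.
Variables (V E : choiceType) (Gam : multiquiver V E).
Hypothesis bal : cycles_balanced Gam.

Lemma balanced_cycle_potential_at (F : numDomainType) (a : V -> F)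
    n (v : 'I_n -> V) (e : 'I_n -> E) out inn j :
  (forall w, a w != 0) -> injective v -> injective e ->
  (forall i, joins Gam (e i) (v i, out i) (v (ordS i), inn i)) ->
  (forall i, i != j -> potential_at Gam a (e i)) -> potential_at Gam a (e j).
Proof.
move=> a_neq0 v_inj e_inj e_joins a_pot.
have n_gt0 : (0 < n)%N by case: n j {v e out inn v_inj e_inj e_joins a_pot} => // -[].
apply: (joins_potential_at (e_joins j)) => /=.
pose before i := a (v i) * (out i)%:R; pose after i := a (v (ordS i)) * (inn i)%:R.
have beforeE i : i != j -> before i = after i by move=> /a_pot/(_ _ _ (e_joins i)).
have : \prod_i before i = \prod_i after i.
  rewrite !big_split /= -!natr_prod (simple_cycle_balanced bal n_gt0 v_inj e_inj e_joins).
  by rewrite (prod_ordS (fun i => a (v i))).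
rewrite !(bigD1 (P := predT) j) //= (eq_bigr after beforeE).
apply: mulIf; apply/prodf_neq0 => i /beforeE <-.
by rewrite mulf_neq0 // pnatr_eq0 -lt0n; exact: joins_gt0 (e_joins i).
Qed.

Section ExtendByEdge.
Variables (s : seq E) (a : V -> rat).
Hypotheses (a_neq0 : forall w, a w != 0) (a_pot : forall e, e \in s -> potential_at Gam a e).

Definition adjacent : rel V := fun u w =>
  has (fun e => `[< exists m n, joins Gam e (u, m) (w, n) >]) s.

Lemma adjacentP u w :
  reflect (exists2 e, e \in s & exists m n, joins Gam e (u, m) (w, n)) (adjacent u w).
Proof. by apply: (iffP hasP) => -[e es /asboolP e_uw]; exists e => //; apply/asboolP. Qed.

Definition linked_by (u w : V) : Prop := exists2 p, path adjacent u p & last u p = w.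

Lemma linked_by_joins e u x y : e \in s -> joins Gam e x y ->
  linked_by u x.1 <-> linked_by u y.1.
Proof.
have linked_step x' y' : e \in s -> joins Gam e x' y' -> linked_by u x'.1 -> linked_by u y'.1.
  move=> es e_xy [p u_path u_last]; exists (rcons p y'.1); last exact: last_rcons.
  rewrite rcons_path u_path u_last; apply/adjacentP; exists e => //.
  by exists x'.2, y'.2; rewrite -!surjective_pairing.
by move=> es e_xy; split; apply: linked_step => //; rewrite joins_sym.
Qed.

(* A simple path from one end of a new edge to the other closes up to a cycle. *)
Lemma linked_by_cycle e0 x y : e0 \notin s -> joins Gam e0 x y -> linked_by y.1 x.1 ->
  exists n (v : 'I_n.+1 -> V) (e : 'I_n.+1 -> E) out inn,
    [/\ injective v, injective e,
        forall i, joins Gam (e i) (v i, out i) (v (ordS i), inn i),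
        e ord_max = e0 & forall i, i != ord_max -> e i \in s].
Proof.
move=> e0s e0_xy [p0 /shortenP[p y_path y_uniq _] y_last].
pose v (i : 'I_(size p).+1) := nth y.1 (y.1 :: p) i.
have v_inj : injective v.
  by move=> i j /eqP; rewrite nth_uniq ?ltn_ord // => /eqP/val_inj.
have lt_max (i : 'I_(size p).+1) : i != ord_max -> (i < size p)%N.
  by move=> i_max; rewrite ltn_neqAle -ltnS ltn_ord andbT.
have ordSE (i : 'I_(size p).+1) : i != ord_max -> ordS i = i.+1 :> nat.
  by move=> /lt_max i_lt; rewrite /= modn_small.
have /choice[t tE] (i : 'I_(size p).+1) : exists t : E * (nat * nat),
    joins Gam t.1 (v i, t.2.1) (v (ordS i), t.2.2) /\
    if i == ord_max then t.1 = e0 else t.1 \in s.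
  have [->|i_max] := eqVneq i ord_max.
    exists (e0, (x.2, y.2)); rewrite /= /v /= modnn /= nth_last /= y_last.
    by rewrite -!surjective_pairing.
  have /adjacentP[e es [m [k e_joins]]] := pathP y.1 y_path i (lt_max i i_max).
  by exists (e, (m, k)); rewrite /= {2}/v (ordSE i i_max).
have t_joins i := (tE i).1; have t_max : (t ord_max).1 = e0.
  by have [_] := tE ord_max; rewrite eqxx.
have t_s i : i != ord_max -> (t i).1 \in s.
  by move=> i_max; have [_] := tE i; rewrite (negbTE i_max).
exists (size p), v, (fst \o t), (fun i => (t i).2.1), (fun i => (t i).2.2).
split=> // i j /= t_ij.
have [i_max|i_max] := eqVneq i ord_max; have [j_max|j_max] := eqVneq j ord_max.
- by rewrite i_max j_max.
- by case/negP: e0s; rewrite -t_max -i_max t_ij t_s.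
- by case/negP: e0s; rewrite -t_max -j_max -t_ij t_s.
have := t_joins i; rewrite t_ij => i_joins.
case: (joins_inj i_joins (t_joins j)) => -[] [v_ji _] [v_SS _]; first exact/esym/v_inj.
have /(congr1 (@nat_of_ord _)) := v_inj _ _ v_ji; rewrite ordSE // => ji.
by have /(congr1 (@nat_of_ord _)) := v_inj _ _ v_SS; rewrite ordSE //; lia.
Qed.

Lemma extend_potential e0 : exists2 b : V -> rat, forall w, b w != 0 &
  forall e, e \in e0 :: s -> potential_at Gam b e.
Proof.
have [a_e0|] := pselect (potential_at Gam a e0).
  by exists a => // e; rewrite inE => /predU1P[->|/a_pot].
move=> /existsNP[x /existsNP[y /not_implyP[e0_xy a_xy]]].
have e0s : e0 \notin s by apply/negP => /a_pot/(_ _ _ e0_xy).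
have not_linked : ~ linked_by y.1 x.1.
  move=> /(linked_by_cycle e0s e0_xy)[n [v [e [out [inn [v_inj e_inj e_joins e_max e_s]]]]]].
  have := balanced_cycle_potential_at (j := ord_max) a_neq0 v_inj e_inj e_joins.
  by rewrite e_max => /(_ (fun i i_max => a_pot (e_s i i_max)))/(_ _ _ e0_xy).
have mult_neq0 x' y' e : joins Gam e x' y' -> a x'.1 * x'.2%:R != 0.
  by move=> /joins_gt0 x'_gt0; rewrite mulf_neq0 // pnatr_eq0 -lt0n.
have x_neq0 := mult_neq0 _ _ _ e0_xy.
have y_neq0 : a y.1 * y.2%:R != 0 by apply: (mult_neq0 y x e0); rewrite joins_sym.
pose c := a x.1 * x.2%:R / (a y.1 * y.2%:R).
have c_neq0 : c != 0 by rewrite mulf_neq0 ?invr_neq0.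
exists (fun w => if `[< linked_by y.1 w >] then c * a w else a w) => [w|e].
  by case: ifP => _ //; rewrite mulf_neq0.
rewrite inE => /predU1P[->|es].
  apply: (joins_potential_at e0_xy); rewrite asboolF // asboolT; last by exists [::].
  by rewrite -mulrA /c divfK.
move=> x' y' e_xy; rewrite (asbool_equiv_eq (linked_by_joins y.1 es e_xy)).
by case: ifP => _; rewrite -?mulrA (a_pot es e_xy).
Qed.
End ExtendByEdge.

Lemma seq_potential (s : seq E) :
  exists2 a : V -> rat, forall w, a w != 0 & forall e, e \in s -> potential_at Gam a e.
Proof.
elim: s => [|e s [a a_neq0 a_pot]]; first by exists (fun=> 1) => // w; rewrite oner_eq0.
exact: extend_potential a_neq0 a_pot e.
Qed.

Lemma finite_rat_potential : finite_set [set: V]%classic ->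
  exists2 a : V -> rat, forall w, a w != 0 & potential Gam a.
Proof.
move=> V_fin; pose s := flatten [seq (edges_at Gam v : seq E) | v <- fset_set [set: V]%classic].
have [a a_neq0 a_pot] := seq_potential s; exists a => // e x y e_xy.
apply: a_pot (e_xy); apply/flatten_mapP; exists x.1; first by rewrite in_fset_set // inE.
by rewrite mem_edges_at; exact: joins_incident e_xy.
Qed.

Lemma finite_int_potential : finite_set [set: V]%classic ->
  exists2 a : V -> int, forall w, a w != 0 & potential Gam a.
Proof.
move=> V_fin; have [b b_neq0 b_pot] := finite_rat_potential V_fin.
pose d := fset_set [set: V]%classic.
have dV v : v \in d by rewrite in_fset_set // inE.
pose D : int := \prod_(w <- d) denq (b w).
have D_neq0 : D != 0 by rewrite prodf_seq_neq0; apply/allP => w _; exact: denq_neq0.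
have [a aE] : exists a : V -> int, forall v, (a v)%:~R = b v * D%:~R.
  exists (fun v => numq (b v) * \prod_(w <- (d `\ v)%fset) denq (b w)) => v.
  by rewrite /D (big_fsetD1 v (dV v)) /= !rmorphM /= numqE mulrA.
exists a => [w|e x y e_xy]; first by rewrite -(intr_eq0 rat) aE mulf_neq0 // intr_eq0.
apply: (@intr_inj rat); rewrite !rmorphM /= !aE !rmorph_nat.
by rewrite mulrAC (b_pot e _ _ e_xy) mulrAC.
Qed.
End BalancedPotential.

(** * The kernel of the incidence matrix *)

Section Kernel.
Variables (V E : choiceType) (Gam : multiquiver V E).

Definition end_val (a : {malg V}) (x : option (V * nat)) : int :=
  if x is Some (v, n) then a@_v * n%:R else 0.

Lemma mcoeff_gamma a e :
  (gamma Gam a)@_e = end_val a (tgt Gam e) - end_val a (src Gam e).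
Proof.
elim/malg_ind: a => [|a b IHa IHb|c v].
- have end_val0 x : end_val 0 x = 0 by case: x => [[v n]|] //=; rewrite mcoeff0 mul0r.
  by rewrite raddf0 mcoeff0 !end_val0 subrr.
- have end_valD x : end_val (a + b) x = end_val a x + end_val b x.
    by case: x => [[v n]|] /=; rewrite ?addr0 // mcoeffD mulrDl.
  by rewrite raddfD mcoeffD IHa IHb !end_valD opprD addrACA.
have end_valU x : end_val << c *g v >> x = c * end_coef x v.
  case: x => [[w n]|]; rewrite /end_coef /has_vertex /= ?mulr0 // mcoeffU (inj_eq Some_inj) eq_sym.
  by case: eqP => _; rewrite ?natz // mul0r mulr0.
by rewrite mcoeff_gammaU gamma_coefE !end_valU mulrBr.
Qed.

Lemma gamma_eq0P a :
  gamma Gam a = 0 <-> forall e, end_val a (tgt Gam e) = end_val a (src Gam e).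
Proof.
split=> [a0 e|endE]; last by apply/malgP => e; rewrite mcoeff_gamma endE subrr mcoeff0.
by apply/eqP; rewrite -subr_eq0 -mcoeff_gamma a0 mcoeff0.
Qed.

Lemma gamma_ker_potential a : gamma Gam a = 0 -> potential Gam (mcoeff^~ a).
Proof.
move=> /gamma_eq0P endE e [u m] [v n]; have := endE e; rewrite /joins.
by move=> + /orP[] /andP[/eqP s_e /eqP t_e]; rewrite s_e t_e.
Qed.

Lemma linked_incident x v e : incident Gam v e ->
  linked Gam x (inl v) <-> linked Gam x (inr e).
Proof.
move=> ve; split=> x_linked; apply: rst_trans x_linked _; last apply: rst_sym;
  exact: rst_step.
Qed.

Lemma component_leaf x e : leaf (component Gam x) e = leaf Gam (val e).
Proof.
have /[!inE] x_e := valP e.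
have restrict_None y : (forall v n, y = Some (v, n) -> incident Gam v (val e)) ->
    (restrict_end [set v | linked Gam x (inl v)]%classic y == None) = (y == None).
  case: y => [[v n]|] //= /(_ v n erefl) ve; rewrite insubT //.
  by rewrite inE; apply/(linked_incident x ve).
by rewrite /leaf /= !restrict_None // => v n; rewrite /incident /has_vertex => ->;
  rewrite eqxx ?orbT.
Qed.

Lemma incident_end v e : incident Gam v e ->
  exists2 n, (0 < n)%N & src Gam e = Some (v, n) \/ tgt Gam e = Some (v, n).
Proof.
rewrite /incident /has_vertex; case s_e : (src Gam e) => [[u m]|];
  case t_e : (tgt Gam e) => [[w n]|] //=; rewrite ?orbF.
- move=> /orP[] /eqP[uv]; [exists m; last left|exists n; last right]; rewrite -?uv //.
    exact: src_gt0 s_e.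
  exact: tgt_gt0 t_e.
- by move=> /eqP[uv]; exists m; [exact: src_gt0 s_e|left; rewrite -uv].
- by move=> /eqP[uv]; exists n; [exact: tgt_gt0 t_e|right; rewrite -uv].
Qed.

Lemma gamma_ker_linked_neq0 a v0 : gamma Gam a = 0 -> a@_v0 != 0 ->
  (forall v, linked Gam (inl v0) (inl v) -> a@_v != 0) /\
  (forall e, linked Gam (inl v0) (inr e) -> end_val a (src Gam e) != 0).
Proof.
move=> /gamma_eq0P endE a_v0.
pose nonzero (y : V + E) : bool := match y with
  | inl v => a@_v != 0 | inr e => end_val a (src Gam e) != 0 end.
suff linked_nonzero y z : linked Gam y z -> nonzero y = nonzero z.
  by split=> [v|e] /linked_nonzero /=; rewrite a_v0.
elim=> {y z} [[v|e] [w|e'] //= /incident_end[n n_gt0 v_end]|//|//|x y z _ -> _ -> //].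
have -> : end_val a (src Gam e') = a@_v * n%:R.
  by case: v_end => v_end; [rewrite v_end|rewrite -endE v_end].
by rewrite mulf_eq0 pnatr_eq0 (gtn_eqF n_gt0) orbF.
Qed.

Lemma gamma_ker_equilibrium a v0 : gamma Gam a = 0 -> a@_v0 != 0 ->
  in_equilibrium (component Gam (inl v0)).
Proof.
move=> a0 a_v0; have [v_neq0 e_neq0] := gamma_ker_linked_neq0 a0 a_v0.
have a_neq0 (v : [set v | linked Gam (inl v0) (inl v)]%classic) : a@_(val v) != 0.
  by apply: v_neq0; have := valP v; rewrite inE.
split=> [|e|V' E'].
- have := @finite_preimage _ _ [set` msupp a]%classic
    (val : [set v | linked Gam (inl v0) (inl v)]%classic -> V) (in2W val_inj) (finite_fset _).
  apply: sub_finite_set => v _ /=; rewrite -mcoeff_neq0; exact: a_neq0.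
- have /[!inE] /e_neq0 := valP e; rewrite component_leaf /leaf.
  have /gamma_eq0P/(_ (val e)) := a0.
  by case: (src Gam (val e)) => [x|] /=; case: (tgt Gam (val e)) => [y|] //= <-; rewrite eqxx.
have a_pot := potential_subgraph (potential_subgraph (gamma_ker_potential a0)).
by apply: potential_balanced (a_pot _ _ _ _) => v; exact: a_neq0.
Qed.

Lemma equilibrium_vertex x : in_equilibrium (component Gam x) ->
  exists v, v \in [set v | linked Gam x (inl v)]%classic.
Proof.
case: x => [v _|e [_ no_leaf _]]; first by exists v; rewrite inE; exact: rst_refl.
have e_linked : e \in [set f | linked Gam (inr e) (inr f)]%classic.
  by rewrite inE; exact: rst_refl.
have := no_leaf (exist (fun f => f \in [set f | linked Gam (inr e) (inr f)]%classic) e e_linked).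
rewrite /leaf /= negb_or => /andP[]; case: restrict_end => [[v n]|] // _ _.
by exists (val v); exact: valP.
Qed.

Definition extend0 (C : set V) (b : C -> int) : {malg V} :=
  \sum_(v <- fset_set [set: C]%classic) << b v *g val v >>.

Lemma mcoeff_extend0 (C : set V) (b : C -> int) v :
  finite_set [set: C]%classic -> (extend0 b)@_(val v) = b v.
Proof. by move=> C_fin; rewrite (mcoeff_sumU _ _ _ val_inj) in_fset_set ?mem_setT. Qed.

Lemma mcoeff_extend0_out (C : set V) (b : C -> int) v : v \notin C -> (extend0 b)@_v = 0.
Proof.
move=> vC; rewrite raddf_sum /= big1 // => w _; rewrite mcoeffU.
by case: eqVneq => // wv; case/negP: vC; rewrite -wv; exact: valP.
Qed.

Lemma gamma_extend0 x (b : [set v | linked Gam x (inl v)]%classic -> int) :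
  finite_set [set: [set v | linked Gam x (inl v)]]%classic ->
  (forall e, ~~ leaf (component Gam x) e) -> potential (component Gam x) b ->
  gamma Gam (extend0 b) = 0.
Proof.
move=> C_fin no_leaf b_pot; apply/gamma_eq0P => e.
have [x_e|x_e] := boolP (e \in [set f | linked Gam x (inr f)]%classic).
  have := no_leaf (exist _ e x_e); rewrite /leaf /= negb_or.
  case s_e : restrict_end => [[v m]|] //; case t_e : restrict_end => [[w n]|] // _.
  rewrite (restrict_endP s_e) (restrict_endP t_e) /= !mcoeff_extend0 //.
  by apply/esym/(b_pot (exist _ e x_e) (v, m) (w, n)); rewrite /joins /= s_e t_e !eqxx.
have end0 y : (forall v n, y = Some (v, n) -> incident Gam v e) -> end_val (extend0 b) y = 0.
  case: y => [[v n]|] //= /(_ v n erefl) ve; rewrite mcoeff_extend0_out ?mul0r //.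
  by apply: contra x_e; rewrite !inE => /(linked_incident x ve).
by rewrite !end0 // => v n; rewrite /incident /has_vertex => ->; rewrite eqxx ?orbT.
Qed.

Lemma equilibrium_gamma_ker x : in_equilibrium (component Gam x) ->
  exists2 a, a != 0 & gamma Gam a = 0.
Proof.
move=> C_eq; have [v0 x_v0] := equilibrium_vertex C_eq; have [C_fin no_leaf bal] := C_eq.
have [b b_neq0 b_pot] := finite_int_potential bal C_fin.
exists (extend0 b); last exact: gamma_extend0.
apply/eqP => b0; have := b_neq0 (exist _ v0 x_v0).
by rewrite -(mcoeff_extend0 b _ C_fin) b0 mcoeff0 eqxx.
Qed.

Lemma gamma_inj_equilibriumP :
  injective (gamma Gam) <-> forall x, ~ in_equilibrium (component Gam x).
Proof.
split=> [/gamma_injP ker0 x /equilibrium_gamma_ker[a /eqP a_neq0 /ker0] //|no_eq].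
apply/gamma_injP => a a0; apply/malgP => v; rewrite mcoeff0.
by apply/eqP/negP => /negP /(gamma_ker_equilibrium a0); exact: no_eq.
Qed.
End Kernel.

Theorem theorem4p11 (K : fieldType) (charK : [pchar K] =i pred0)
    (V E : choiceType) (Gam : multiquiver V E) :
  [<-> injective (canonical_rep charK Gam);
       injective (gamma Gam);
       max_comm_subalgebra (mq_R charK Gam);
       forall x : V + E, ~ in_equilibrium (component Gam x)].
Proof.
tfae.
- exact: canonical_rep_inj_gamma_inj.
- exact: gamma_inj_mq_R_max.
- by move=> /mq_R_max_gamma_inj /gamma_inj_equilibriumP.
- by move=> /gamma_inj_equilibriumP /gamma_inj_canonical_rep_inj.
Qed.
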